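(* For all positive integers $r$ and $s$ and all $\tau$ in the upper half-plane, \begin{align*} Z^{o}_r(\tau)Z^{e}_s(\tau)+\tfrac14\left(\delta_{r,2}\overline{f}^{e}_s(\tau)+\delta_{s,2}\overline{f}^{o}_r(\tau)\right) &= Z^{oe}_{r,s}(\tau)+Z^{eo}_{s,r}(\tau)\\ &= \sum_{\substack{i+j=r+s\\ i,j\ge1}}\binom{i-1}{r-1}Z^{oe}_{i,j}(\tau)+\sum_{\substack{i+j=r+s\\ i,j\ge1}}\binom{i-1}{s-1}Z^{oo}_{i,j}(\tau), \end{align*} and \begin{align*} Z^{o}_r(\tau)Z^{o}_s(\tau)+\tfrac14\left(\delta_{r,2}\overline{f}^{o}_s(\tau)+\delta_{s,2}\overline{f}^{o}_r(\tau)\right) &= Z^{oo}_{r,s}(\tau)+Z^{oo}_{s,r}(\tau)+Z^{o}_{r+s}(\tau)\\ &= \sum_{\substack{i+j=r+s\\ i,j\ge1}}\left(\binom{i-1}{r-1}+\binom{i-1}{s-1}\right)Z^{eo}_{i,j}(\tau). \end{align*}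
   Context: Let $\tau$ lie in the upper half-plane, $q=e^{2\pi i\tau}$, and let $\delta_{a,b}$ be the Kronecker delta. For $k\ge1$ let $\varphi_k(\tau)=\frac{(-1)^k}{(k-1)!}\sum_{u>0}u^{k-1}q^u$. Let $\widetilde{\zeta}(k)=(2\pi i)^{-k}\zeta(k)$ for $k\ge2$ and $\widetilde{\zeta}(1)=0$. For $r\ge1$ and $s\ge0$ define \[ f^{o}_r(\tau)=\sum_{m>0\text{ odd}}\varphi_r(m\tau),\quad f^{e}_r(\tau)=\sum_{m>0\text{ even}}\varphi_r(m\tau),\quad \overline{f}^{o}_s(\tau)=-\sum_{m>0\text{ odd}}m\,\varphi_{s+1}(m\tau),\quad \overline{f}^{e}_s(\tau)=-\sum_{m>0\text{ even}}m\,\varphi_{s+1}(m\tau). \] For $k\ge1$ set $Z^{o}_k(\tau)=f^{o}_k(\tau)$ and $Z^{e}_k(\tau)=\widetilde{\zeta}(k)+f^{e}_k(\tau)$ (these are $G_k(\tau)-G_k(2\tau)$ and $G_k(2\tau)$ for $G_k(\tau)=\widetilde{\zeta}(k)+\frac{(-1)^k}{(k-1)!}\sum_{n>0}\sigma_{k-1}(n)q^n$). Put $\alpha_1=\overline{f}^{o}_0(\tau)$, $\alpha_2=-\overline{f}^{o}_0(\tau)$, $\alpha_3=2\overline{f}^{o}_0(\tau)+\overline{f}^{e}_0(\tau)$, and for $r,s\ge1$ \begin{align*} \varepsilon^{eo}_{r,s}&=\delta_{r,2}\overline{f}^{o}_s-\delta_{r,1}\overline{f}^{o}_{s-1}+\delta_{s,1}\overline{f}^{e}_{r-1}+\delta_{r,1}\delta_{s,1}\alpha_1,\\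 \varepsilon^{oe}_{r,s}&=\delta_{r,2}\overline{f}^{e}_s-\delta_{r,1}\overline{f}^{e}_{s-1}+\delta_{s,1}\overline{f}^{o}_{r-1}+\delta_{r,1}\delta_{s,1}\alpha_2,\\ \varepsilon^{oo}_{r,s}&=\delta_{r,2}\overline{f}^{o}_s-\delta_{r,1}\overline{f}^{o}_{s-1}+\delta_{s,1}\left(\overline{f}^{o}_{r-1}+2f^{o}_r\right)+\delta_{r,1}\delta_{s,1}\alpha_3 \end{align*} (all evaluated at $\tau$). For all positive integers $r,s$ define \begin{align*} Z^{eo}_{r,s}(\tau)&=\sum_{\substack{m>m'>0\\ m\text{ even},\ m'\text{ odd}}}\varphi_r(m\tau)\varphi_s(m'\tau)+\tfrac14\varepsilon^{eo}_{r,s}(\tau),\\ Z^{oe}_{r,s}(\tau)&=\sum_{\substack{m>m'>0\\ m\text{ odd},\ m'\text{ even}}}\varphi_r(m\tau)\varphi_s(m'\tau)+\widetilde{\zeta}(s)f^{o}_r(\tau)+\tfrac14\varepsilon^{oe}_{r,s}(\tau),\\ Z^{oo}_{r,s}(\tau)&=\sum_{\substack{m>m'>0\\ m,m'\text{ odd}}}\varphi_r(m\tau)\varphi_s(m'\tau)+\sum_{\substack{p+h=r+s\\ p,h\ge1}}\left((-1)^s\binom{p-1}{s-1}+(-1)^{p+r}\binom{p-1}{r-1}\right)\widetilde{\zeta}(p)f^{o}_h(\tau)+\tfrac14\varepsilon^{oo}_{r,s}(\tau). \end{align*}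
   Formalization: The equality of Z^o_r Z^o_s + … with Z^oo_{r,s} + Z^oo_{s,r} + Z^o_{r+s} is stated only for (r,s) ≠ (1,1); at r = s = 1 the two chains together would force Z^o_2 = 0, but Z^o_2 = q + 2q² + … is nonzero. All other equalities hold for all r, s ≥ 1. *)

(* Defs.v *)
(* Stdlib reals + Coquelicot: complex numbers are [Coquelicot.Complex.C]. *)
From Stdlib Require Import Reals Arith.
From mathcomp Require binomial.
From Coquelicot Require Import Coquelicot.

Open Scope C_scope.

(* Stdlib's real-valued binomial does not vanish for [n < k] (it is computed
   with a truncated [n - k]), so MathComp's is used. *)
Definition binC (n k : nat) : C := RtoC (INR (binomial.binomial n k)).

Definition sgnC (n : nat) : C := Cpow (RtoC (-1)) n.

Definition delta (a b : nat) : C :=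
  if Nat.eqb a b then RtoC 1 else RtoC 0.

Definition Cexp (z : C) : C :=
  (exp (Re z) * cos (Im z), exp (Re z) * sin (Im z))%R.

(* Coquelicot's [Series] is real-valued only; like it, [CSeries] is the sum of
   the series when it converges and is unspecified otherwise. *)
Definition CSeries (a : nat -> C) : C :=
  (Series (fun n => Re (a n)), Series (fun n => Im (a n))).

Lemma CSeries_unique (a : nat -> C) (l : C) : is_series a l -> CSeries a = l.
Proof.
  destruct l as [x y]; intros H; unfold CSeries.
  assert (Hfst : forall n, fst (sum_n a n) = sum_n (fun k => Re (a k)) n).
  { intros n; induction n as [|n IH].
    - now rewrite !sum_O.
    - rewrite !sum_Sn, <- IH; reflexivity. }
  assert (Hsnd : forall n, snd (sum_n a n) = sum_n (fun k => Im (a k)) n).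
  { intros n; induction n as [|n IH].
    - now rewrite !sum_O.
    - rewrite !sum_Sn, <- IH; reflexivity. }
  f_equal; apply is_series_unique; intros P [eps HP].
  - assert (HQ : locally (T := C_UniformSpace) (x, y)
                   (fun z : C => P (fst z))).
    { exists eps; intros z [Hz _]; now apply HP. }
    destruct (H _ HQ) as [N HN]; exists N; intros n Hn.
    rewrite <- Hfst; now apply HN.
  - assert (HQ : locally (T := C_UniformSpace) (x, y)
                   (fun z : C => P (snd z))).
    { exists eps; intros z [_ Hz]; now apply HP. }
    destruct (H _ HQ) as [N HN]; exists N; intros n Hn.
    rewrite <- Hsnd; now apply HN.
Qed.

(* Sum of [a m] over the integers [m > 0] satisfying [P]. *)
Definition sum_pos (P : nat -> bool) (a : nat -> C) : C :=
  CSeries (fun n => if P (S n) then a (S n) else RtoC 0).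

(* Sum of [a i j] over the pairs [i, j >= 1] with [i + j = k]. *)
Definition sum_pairs (k : nat) (a : nat -> nat -> C) : C :=
  sum_n_m (fun i => a i (k - i)%nat) 1 (k - 1).

Definition twopii : C := RtoC (2 * PI) * Ci.

Definition qexp (tau : C) : C := Cexp (twopii * tau).

Definition phi (k : nat) (tau : C) : C :=
  sgnC k / RtoC (INR (fact (k - 1))) *
  sum_pos (fun _ => true)
    (fun u => RtoC (INR u ^ (k - 1))%R * Cpow (qexp tau) u).

(* The value at [tau] of [phi k (m tau)]. *)
Definition phim (k m : nat) (tau : C) : C := phi k (RtoC (INR m) * tau).

(* Used only for [k >= 2]. *)
Definition zeta (k : nat) : R := Series (fun n => / (INR (S n) ^ k))%R.

Definition zetat (k : nat) : C :=
  if Nat.eqb k 1 then RtoC 0 else RtoC (zeta k) / Cpow twopii k.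

Definition fo (r : nat) (tau : C) : C :=
  sum_pos Nat.odd (fun m => phim r m tau).
Definition fe (r : nat) (tau : C) : C :=
  sum_pos Nat.even (fun m => phim r m tau).
Definition fbaro (s : nat) (tau : C) : C :=
  - sum_pos Nat.odd (fun m => RtoC (INR m) * phim (s + 1) m tau).
Definition fbare (s : nat) (tau : C) : C :=
  - sum_pos Nat.even (fun m => RtoC (INR m) * phim (s + 1) m tau).

Definition Zo (k : nat) (tau : C) : C := fo k tau.
Definition Ze (k : nat) (tau : C) : C := zetat k + fe k tau.

Definition alpha1 (tau : C) : C := fbaro 0 tau.
Definition alpha2 (tau : C) : C := - fbaro 0 tau.
Definition alpha3 (tau : C) : C := RtoC 2 * fbaro 0 tau + fbare 0 tau.

Definition epseo (r s : nat) (tau : C) : C :=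
  delta r 2 * fbaro s tau - delta r 1 * fbaro (s - 1) tau
  + delta s 1 * fbare (r - 1) tau + delta r 1 * delta s 1 * alpha1 tau.
Definition epsoe (r s : nat) (tau : C) : C :=
  delta r 2 * fbare s tau - delta r 1 * fbare (s - 1) tau
  + delta s 1 * fbaro (r - 1) tau + delta r 1 * delta s 1 * alpha2 tau.
Definition epsoo (r s : nat) (tau : C) : C :=
  delta r 2 * fbaro s tau - delta r 1 * fbaro (s - 1) tau
  + delta s 1 * (fbaro (r - 1) tau + RtoC 2 * fo r tau)
  + delta r 1 * delta s 1 * alpha3 tau.

(* Sum of [phi r (m tau) * phi s (m' tau)] over [m > m' > 0] with [P m] and
   [P' m'], taken first over [m']. *)
Definition dsum (P P' : nat -> bool) (r s : nat) (tau : C) : C :=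
  sum_pos P (fun m =>
    sum_n_m (fun m' => if P' m' then phim r m tau * phim s m' tau else RtoC 0)
      1 (m - 1)).

Definition quarter : C := RtoC (1 / 4).

Definition Zeo (r s : nat) (tau : C) : C :=
  dsum Nat.even Nat.odd r s tau + quarter * epseo r s tau.

Definition Zoe (r s : nat) (tau : C) : C :=
  dsum Nat.odd Nat.even r s tau + zetat s * fo r tau
  + quarter * epsoe r s tau.

Definition Zoo (r s : nat) (tau : C) : C :=
  dsum Nat.odd Nat.odd r s tau
  + sum_pairs (r + s) (fun p h =>
      (sgnC s * binC (p - 1) (s - 1) + sgnC (p + r) * binC (p - 1) (r - 1))
      * zetat p * fo h tau)
  + quarter * epsoo r s tau.

(* Main.v *)
(** With [q = e^(2 pi i tau)] and [Phi_r(x) = (-1)^r/(r-1)! sum_u u^(r-1) x^u] one has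
    [phi_r(m tau) = Phi_r(q^m)]. Splitting a square sum [sum_(u, v)] according to
    [u > v], [u < v], [u = v] is used twice. Over the outer indices [m, m'] it gives the
    harmonic products of [f^o] and [f^e]; the diagonal [m = m'] is rewritten with
    [sum_(u+v=n) u^(r-1) v^(s-1)], a Faulhaber type sum whose Bernoulli numbers are the
    even zeta values. Over the inner indices [u, v] it gives a partial fraction formula
    expressing [Phi_r(x) Phi_s(y)] through products [Phi_i(xy) Phi_j(x)] and
    [Phi_i(xy) Phi_j(y)]; summed over [m + m' = M], where [x y = q^M], this is the shuffle
    product. What remains is to compare the coefficients of the [zeta~(p)] and the
    correction terms. Euler's evaluation of the even zeta values follows from
    [zeta(2) = pi^2/6] and his quadratic recurrence, which is the Riccati equation
    [X B' = B - B^2 - X B] of [B = X/(e^X - 1)]. *)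

Require Import Defs.
From Stdlib Require Import Reals Arith Lra Lia Psatz.
From Coquelicot Require Import Coquelicot.
From HB Require Import structures.
From mathcomp Require ssreflect ssrfun ssrbool eqtype ssrnat seq choice fintype div.
From mathcomp Require ssrAC bigop binomial zify_ssreflect.

Local Open Scope C_scope.

(** Parity decides the shape of the relations. Indices of opposite parity never coincide, so only
    [f^o f^o] has a harmonic diagonal; odd plus even is odd and odd plus odd is even, so the shuffle
    of [f^o f^e] lands in types [oe] and [oo], that of [f^o f^o] in type [eo]. The inner diagonal
    [u = v] depends on [M = m + m'] alone and is counted once for each admissible [m]; this number
    is linear in [M], which is the origin of the series [fbar] and hence of the correction terms.

    Zeta values enter in two ways. In the shuffle relations they are free symbols and cancel by
    binomial identities. In the harmonic product of [f^o f^o], symmetry in [r] and [s] produces the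
    factor [1 + (-1)^p], which removes the odd ones, and the even ones must be identified with
    Bernoulli numbers. Euler's recurrence is unchanged when [zeta(2n)] becomes [c^n zeta(2n)], so
    [zeta(2)] is needed to fix the scale.

    Square splittings are identities between partial sums and rearrange nothing; only the Cauchy
    product does. *)

Module DoubleSums.
Import boot.ssreflect boot.ssrfun boot.ssrbool eqtype ssrnat seq choice fintype div.
Import ssrAC bigop binomial zify_ssreflect.SsreflectZifyInstances.
Set Implicit Arguments.
Unset Strict Implicit.
Unset Printing Implicit Defensive.

(** * Finite sums and limits of complex sequences *)

HB.instance Definition _ :=
  Monoid.isComLaw.Build C (RtoC 0) Cplus Cplus_assoc Cplus_comm Cplus_0_l.
HB.instance Definition _ :=
  Monoid.isMulLaw.Build C (RtoC 0) Cmult Cmult_0_l Cmult_0_r.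
Fact Cmult_Dl : left_distributive Cmult Cplus. Proof. by move=> x y z; ring. Qed.
Fact Cmult_Dr : right_distributive Cmult Cplus. Proof. by move=> x y z; ring. Qed.
HB.instance Definition _ :=
  Monoid.isAddLaw.Build C Cmult Cplus Cmult_Dl Cmult_Dr.

Fact Rplus_A : associative Rplus. Proof. by move=> x y z; ring. Qed.
HB.instance Definition _ :=
  Monoid.isComLaw.Build R 0%R Rplus Rplus_A Rplus_comm Rplus_0_l.
HB.instance Definition _ :=
  Monoid.isMulLaw.Build R 0%R Rmult Rmult_0_l Rmult_0_r.
Fact Rmult_Dl : left_distributive Rmult Rplus. Proof. by move=> x y z; ring. Qed.
Fact Rmult_Dr : right_distributive Rmult Rplus. Proof. by move=> x y z; ring. Qed.
HB.instance Definition _ :=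
  Monoid.isAddLaw.Build R Rmult Rplus Rmult_Dl Rmult_Dr.

Notation "\csum_ ( m <= i < n ) F" :=
  (\big[Cplus/RtoC 0]_(m <= i < n) F%C)
  (at level 41, F at level 41, i, m, n at level 50).
Notation "\rsum_ ( m <= i < n ) F" :=
  (\big[Rplus/0%R]_(m <= i < n) F%R)
  (at level 41, F at level 41, i, m, n at level 50).

Section Rearrange.
Variables (T : Type) (idx : T) (op : Monoid.com_law idx).

(** Induction on [n]: the step adds a row, a column and a corner to the square, one piece for each
    term on the right. *)
Lemma big_square_split (F : nat -> nat -> T) (n : nat) :
  \big[op/idx]_(1 <= u < n.+1) \big[op/idx]_(1 <= v < n.+1) F u v =
  op (op (\big[op/idx]_(1 <= u < n.+1) \big[op/idx]_(1 <= v < u) F u v)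
         (\big[op/idx]_(1 <= u < n.+1) \big[op/idx]_(1 <= v < u) F v u))
     (\big[op/idx]_(1 <= u < n.+1) F u u).
Proof.
elim: n => [|n IH]; first by rewrite !big_geq // !Monoid.mul1m.
rewrite big_nat_recr //=.
under eq_bigr => u _ do rewrite big_nat_recr //=.
rewrite big_split /= IH !(big_nat_recr n.+1) //=.
by rewrite [LHS](AC (4*2) ((1*5)*(2*4)*(3*6))).
Qed.

(** Substitute [v = N - u]. The triangle is written as a part of the square so that its complement
    can be estimated; this is needed over both C and R, hence the abstract monoid. *)
Lemma big_triangle (F : nat -> nat -> T) (n : nat) :
  \big[op/idx]_(1 <= N < n.+1) \big[op/idx]_(1 <= u < N) F u (N - u)%N =
  \big[op/idx]_(1 <= u < n.+1) \big[op/idx]_(1 <= v < n.+1 | (u + v <= n)%N) F u v.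
Proof.
transitivity (\big[op/idx]_(1 <= N < n.+1)
    \big[op/idx]_(1 <= u < n.+1 | (u < N)%N) F u (N - u)%N).
  apply: eq_big_nat => N HN; rewrite (@big_nat_widen _ _ _ 1 N n.+1) //; lia.
rewrite (exchange_big_dep_nat predT) //=; apply: eq_big_nat => u Hu.
transitivity (\big[op/idx]_(u.+1 <= N < n.+1) F u (N - u)%N).
  by rewrite [RHS](@big_nat_widenl _ _ _ u.+1 1 n.+1).
rewrite -[u.+1]add1n big_addn.
rewrite (@big_nat_widen _ _ _ 1 (n.+1 - u) n.+1); last by lia.
apply: congr_big_nat => // v Hv; first by lia.
by congr F; lia.
Qed.

End Rearrange.

Definition clim (u : nat -> C) (l : C) : Prop :=
  is_lim_seq (fun n => Re (u n)) (Re l) /\ is_lim_seq (fun n => Im (u n)) (Im l).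

Lemma clim_ext u v l : (forall n, u n = v n) -> clim u l -> clim v l.
Proof.
move=> e [h1 h2]; split.
  by apply: is_lim_seq_ext h1 => n; rewrite e.
by apply: is_lim_seq_ext h2 => n; rewrite e.
Qed.

Lemma clim_unique u l l' : clim u l -> clim u l' -> l = l'.
Proof.
move=> [h1 h2] [h3 h4].
have e1 := is_lim_seq_unique _ _ h1; have e2 := is_lim_seq_unique _ _ h2.
have e3 := is_lim_seq_unique _ _ h3; have e4 := is_lim_seq_unique _ _ h4.
rewrite e1 in e3; rewrite e2 in e4; case: e3; case: e4.
by case: l l' {h1 h2 h3 h4 e1 e2} => a b [c d] /= -> ->.
Qed.

Lemma clim_const l : clim (fun _ => l) l.
Proof. by split; apply: is_lim_seq_const. Qed.

Lemma clim_plus u v l l' : clim u l -> clim v l' -> clim (fun n => u n + v n) (l + l').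
Proof. by move=> [h1 h2] [h3 h4]; split; apply: is_lim_seq_plus'. Qed.

Lemma clim_mult u v l l' : clim u l -> clim v l' -> clim (fun n => u n * v n) (l * l').
Proof.
move=> [h1 h2] [h3 h4]; split => /=.
  by apply: is_lim_seq_minus'; apply: is_lim_seq_mult'.
by apply: is_lim_seq_plus'; apply: is_lim_seq_mult'.
Qed.

Lemma clim_le0 u (e : nat -> R) :
  (forall n, Cmod (u n) <= e n)%R -> is_lim_seq e 0%R -> clim u (RtoC 0).
Proof.
move=> H He.
have Hm : is_lim_seq (fun n => - e n)%R 0%R.
  by have := proj1 (is_lim_seq_opp _ _) He; rewrite /= Ropp_0.
by split; apply: (is_lim_seq_le_le _ _ _ _ _ Hm He) => n;
  have := H n; have := Rmax_Cmod (u n);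
  have := Rmax_l (Rabs (Re (u n))) (Rabs (Im (u n)));
  have := Rmax_r (Rabs (Re (u n))) (Rabs (Im (u n)));
  rewrite /Re /Im => *; apply/Rabs_le_between; lra.
Qed.

Lemma csum_Re (F : nat -> C) m n :
  Re (\csum_(m <= i < n) F i) = \rsum_(m <= i < n) Re (F i).
Proof. exact: (big_morph Re). Qed.
Lemma csum_Im (F : nat -> C) m n :
  Im (\csum_(m <= i < n) F i) = \rsum_(m <= i < n) Im (F i).
Proof. exact: (big_morph Im). Qed.
Lemma csum_RtoC (F : nat -> R) m n :
  RtoC (\rsum_(m <= i < n) F i) = \csum_(m <= i < n) RtoC (F i).
Proof. by apply: (big_morph RtoC) => // x y; rewrite RtoC_plus. Qed.

Lemma sum_n_rsum (f : nat -> R) n : sum_n f n = \rsum_(1 <= i < n.+2) f i.-1.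
Proof.
elim: n => [|n IH]; first by rewrite sum_O big_nat1.
by rewrite sum_Sn IH [RHS]big_nat_recr.
Qed.

Lemma rsum_le (F G : nat -> R) m n :
  (forall i, (m <= i < n)%N -> F i <= G i)%R ->
  (\rsum_(m <= i < n) F i <= \rsum_(m <= i < n) G i)%R.
Proof.
move=> H; rewrite big_nat_cond [X in (_ <= X)%R]big_nat_cond.
apply: (big_ind2 (fun x y => x <= y)%R) => [|*|i /andP[hi _]]; [lra|lra|exact: H].
Qed.

Lemma Cmod_csum_le (F : nat -> C) m n :
  (Cmod (\csum_(m <= i < n) F i) <= \rsum_(m <= i < n) Cmod (F i))%R.
Proof.
apply: (big_ind2 (fun x y => Cmod x <= y)%R) => [|x1 x2 y1 y2 h1 h2|i _].
- by rewrite Cmod_0; lra.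
- by have := Cmod_triangle x1 y1; lra.
- exact: Rle_refl.
Qed.

(* The term [a 0] is ignored. *)
Definition psum (a : nat -> C) (l : C) : Prop :=
  clim (fun n => \csum_(1 <= i < n.+1) a i) l.
Definition pabs (a : nat -> C) : Prop := ex_series (fun n => Cmod (a n.+1)).

Lemma is_series_rsum (a : nat -> R) (l : R) :
  is_series (fun n => a n.+1) l <->
  is_lim_seq (fun n => \rsum_(1 <= i < n.+1) a i) l.
Proof.
have E n : sum_n (fun n => a n.+1) n = \rsum_(1 <= i < n.+2) a i.
  by rewrite sum_n_rsum; apply: eq_big_nat => i hi; congr a; lia.
split=> H.
  apply/is_lim_seq_incr_1; apply: is_lim_seq_ext E _.
  exact: (H : is_lim_seq (sum_n (fun n => a n.+1)) l).
suff: is_lim_seq (sum_n (fun n => a n.+1)) l by [].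
move/is_lim_seq_incr_1: H; apply: is_lim_seq_ext => n; by rewrite E.
Qed.

Lemma psum_CSeries a l : psum a l -> CSeries (fun n => a n.+1) = l.
Proof.
move=> [h1 h2]; rewrite /CSeries [RHS]surjective_pairing; congr pair.
  apply: is_series_unique; apply/(is_series_rsum (fun n => Re (a n))).
  by apply: is_lim_seq_ext h1 => n; rewrite csum_Re.
apply: is_series_unique; apply/(is_series_rsum (fun n => Im (a n))).
by apply: is_lim_seq_ext h2 => n; rewrite csum_Im.
Qed.

Lemma pabs_psum a : pabs a -> psum a (CSeries (fun n => a n.+1)).
Proof.
move=> H; split => /=.
  apply: (is_lim_seq_ext (fun n => \rsum_(1 <= i < n.+1) Re (a i))) => [n|].
    by rewrite csum_Re.
  apply/(is_series_rsum (fun n => Re (a n))); apply: Series_correct.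
  apply: ex_series_Rabs; apply: ex_series_le H => n /=.
  rewrite /norm /= /abs /= Rabs_Rabsolu.
  exact: Rle_trans (Rmax_l _ _) (Rmax_Cmod _).
apply: (is_lim_seq_ext (fun n => \rsum_(1 <= i < n.+1) Im (a i))) => [n|].
  by rewrite csum_Im.
apply/(is_series_rsum (fun n => Im (a n))); apply: Series_correct.
apply: ex_series_Rabs; apply: ex_series_le H => n /=.
rewrite /norm /= /abs /= Rabs_Rabsolu.
exact: Rle_trans (Rmax_r _ _) (Rmax_Cmod _).
Qed.

Lemma pabs_le a (b : nat -> R) :
  (forall n, Cmod (a n.+1) <= b n)%R -> ex_series b -> pabs a.
Proof.
move=> H; apply: ex_series_le => n; rewrite /norm /= /abs /= Rabs_pos_eq //.
exact: Cmod_ge_0.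
Qed.

Lemma psum_ext a b l : (forall n, (0 < n)%N -> a n = b n) -> psum a l -> psum b l.
Proof.
move=> H; apply: clim_ext => n; apply: eq_big_nat => i hi; apply: H; lia.
Qed.

Lemma psum_unique a l l' : psum a l -> psum a l' -> l = l'.
Proof. exact: clim_unique. Qed.

Lemma psum_plus a b l l' : psum a l -> psum b l' -> psum (fun n => a n + b n) (l + l').
Proof.
move=> h1 h2; apply: clim_ext (clim_plus h1 h2) => n; by rewrite big_split.
Qed.

Lemma psum_scal c a l : psum a l -> psum (fun n => c * a n) (c * l).
Proof.
move=> h; apply: clim_ext (clim_mult (clim_const c) h) => n; by rewrite big_distrr.
Qed.

Lemma psum_csum (a : nat -> nat -> C) (l : nat -> C) m k :
  (forall i, (m <= i < k)%N -> psum (a i) (l i)) ->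
  psum (fun n => \csum_(m <= i < k) a i n) (\csum_(m <= i < k) l i).
Proof.
move=> H; elim: k H => [|k IH] H.
  rewrite big_geq //; apply: clim_ext (clim_const (RtoC 0)) => n.
  by rewrite big1 // => i _; rewrite big_geq.
case: (leqP m k) => hk.
  rewrite big_nat_recr //.
  have h1 : psum (fun n => \csum_(m <= i < k) a i n) (\csum_(m <= i < k) l i).
    by apply: IH => i hi; apply: H; lia.
  have h2 : psum (a k) (l k) by apply: H; lia.
  by apply: psum_ext (psum_plus h1 h2) => n _; rewrite big_nat_recr.
rewrite big_geq //; apply: clim_ext (clim_const (RtoC 0)) => n.
by rewrite big1 // => i _; rewrite big_geq.
Qed.

Lemma psum_square (a b : nat -> C) A B :
  psum a A -> psum b B ->
  clim (fun n => \csum_(1 <= u < n.+1) \csum_(1 <= v < n.+1) a u * b v) (A * B).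
Proof.
move=> h1 h2; apply: clim_ext (clim_mult h1 h2) => n.
by rewrite big_distrlr.
Qed.

Lemma real_cauchy (x y : nat -> R) A B :
  (forall n, 0 <= x n)%R -> (forall n, 0 <= y n)%R ->
  is_series (fun n => x n.+1) A -> is_series (fun n => y n.+1) B ->
  is_lim_seq
    (fun n => \rsum_(1 <= N < n.+1) \rsum_(1 <= u < N) x u * y (N - u)%N) (A * B)%R.
Proof.
move=> hx hy hA hB.
have ax : ex_series (fun n => Rabs (x n.+1)).
  by apply: ex_series_ext (ex_intro _ A hA) => n; rewrite Rabs_pos_eq.
have ay : ex_series (fun n => Rabs (y n.+1)).
  by apply: ex_series_ext (ex_intro _ B hB) => n; rewrite Rabs_pos_eq.
have H := is_series_mult _ _ _ _ hA hB ax ay.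
apply/(is_series_rsum (fun N => \rsum_(1 <= u < N) x u * y (N - u)%N)).
(* Both indices start at 1, so the sum for [N = 1] is empty and the library's Cauchy product is this
   series without its first term. *)
apply: is_series_decr_1; rewrite big_geq // opp_zero plus_zero_r.
apply: is_series_ext H => n.
rewrite -sum_n_Reals sum_n_rsum; apply: eq_big_nat => i hi.
by congr (x _ * y _)%R; rewrite ?minusE; lia.
Qed.

(** Square partial sums tend to [A * B]. They differ from the triangular ones by the terms with
    [u + v > n], which are bounded by the same difference for the series of moduli; that one tends
    to [SA * SB - SA * SB = 0]. *)
Lemma psum_cauchy (a b : nat -> C) A B :
  pabs a -> pabs b -> psum a A -> psum b B ->
  psum (fun N => \csum_(1 <= u < N) a u * b (N - u)%N) (A * B).
Proof.
move=> ha hb hA hB.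
pose T n := \csum_(1 <= u < n.+1) \csum_(1 <= v < n.+1) a u * b v.
pose D n := \csum_(1 <= N < n.+1) \csum_(1 <= u < N) a u * b (N - u)%N.
pose x u := Cmod (a u); pose y u := Cmod (b u).
have [SA hSA] := ha; have [SB hSB] := hb.
pose RT n := \rsum_(1 <= u < n.+1) \rsum_(1 <= v < n.+1) x u * y v.
pose RD n := \rsum_(1 <= N < n.+1) \rsum_(1 <= u < N) x u * y (N - u)%N.
have hRD : is_lim_seq RD (SA * SB)%R.
  by apply: real_cauchy => // n; apply: Cmod_ge_0.
have hRT : is_lim_seq RT (SA * SB)%R.
  move/(is_series_rsum x): hSA => hSA; move/(is_series_rsum y): hSB => hSB.
  apply: is_lim_seq_ext (is_lim_seq_mult' _ _ _ _ hSA hSB) => n.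
  by rewrite big_distrlr.
have hd : is_lim_seq (fun n => RT n - RD n)%R 0%R.
  have := is_lim_seq_minus' _ _ _ _ hRT hRD.
  by rewrite (_ : SA * SB - SA * SB = 0)%R //; ring.
have h0 : clim (fun n => D n - T n) (RtoC 0).
  apply: clim_le0 hd => n; rewrite -Cmod_opp Copp_minus_distr /T /D /RT /RD.
  rewrite (big_triangle _ (fun u v => a u * b v)) (big_triangle _ (fun u v => x u * y v)%R).
  set L := fun u v => (u + v <= n)%N.
  have eC : T n - \csum_(1 <= u < n.+1) \big[Cplus/RtoC 0]_(1 <= v < n.+1 | L u v) (a u * b v) = 
     \csum_(1 <= u < n.+1) \big[Cplus/RtoC 0]_(1 <= v < n.+1 | ~~ L u v) (a u * b v).
    rewrite /T; under eq_bigr => u _ do rewrite (bigID (L u)) /=.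
    by rewrite big_split /=; ring.
  have eR : (RT n - \rsum_(1 <= u < n.+1) \big[Rplus/0%R]_(1 <= v < n.+1 | L u v) (x u * y v) = 
     \rsum_(1 <= u < n.+1) \big[Rplus/0%R]_(1 <= v < n.+1 | ~~ L u v) (x u * y v))%R.
    rewrite /RT; under eq_bigr => u _ do rewrite (bigID (L u)) /=.
    by rewrite big_split /=; ring.
  rewrite -/(T n) -/(RT n) eC eR.
  apply: Rle_trans (Cmod_csum_le _ _ _) _; apply: rsum_le => u _.
  apply: (big_ind2 (fun z r => Cmod z <= r)%R) => [|x1 x2 y1 y2 h1 h2|v _].
  - by rewrite Cmod_0; lra.
  - by have := Cmod_triangle x1 y1; lra.
  - by rewrite Cmod_mult; apply: Rle_refl.
have := clim_plus h0 (psum_square hA hB); rewrite Cplus_0_l.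
by apply: clim_ext => n; rewrite -/(T n) -/(D n); ring.
Qed.

(** * The functions Phi_r and their shuffle product *)

(** Divided powers free the binomial theorem of its coefficients, so that later sums are plain
    convolutions. *)
Definition dpow (n : nat) (x : R) : R := (x ^ n / INR (fact n))%R.
Definition rphi (r u : nat) : R := ((-1) ^ r * dpow (r - 1) (INR u))%R.
Definition aphi (r : nat) (x : C) (u : nat) : C := RtoC (rphi r u) * Cpow x u.
Definition Phi (r : nat) (x : C) : C := CSeries (fun n => aphi r x n.+1).

Lemma INR_binomial n m : (m <= n)%N ->
  INR 'C(n, m) = (INR (fact n) / (INR (fact m) * INR (fact (n - m))))%R.
Proof.
move=> h; have E k : fact k = k`! by elim: k => //= k ->; rewrite factS; lia.
have := bin_fact h; rewrite -!E => /(congr1 INR); rewrite !mult_INR => <-.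
by field; split; apply: INR_fact_neq_0.
Qed.

Lemma dpowD n x y :
  dpow n (x + y) = \rsum_(0 <= l < n.+1) (dpow l x * dpow (n - l) y).
Proof.
rewrite /dpow Stdlib.Reals.Binomial.binomial /Rdiv -sum_n_Reals sum_n_rsum big_distrl /=.
rewrite big_add1 /=; apply: eq_big_nat => i hi; rewrite /Binomial.C.
have := INR_fact_neq_0 n; have := INR_fact_neq_0 i; have := INR_fact_neq_0 (n - i).
by rewrite minusE => *; field.
Qed.

(** Expand [dpow r (x + y)]; a product [dpow l x * dpow s x] is ['C(l + s, s)] times
    [dpow (l + s) x]. Then put [j = l + s]: the added terms [j < s] have a vanishing binomial. *)
Lemma dpow_shuffle r s x y :
  (dpow r (x + y) * dpow s x =
   \rsum_(0 <= j < (r + s).+1) INR 'C(j, s) * (dpow j x * dpow (r + s - j) y))%R.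
Proof.
rewrite (@big_cat_nat _ _ _ s) //=; last by lia.
rewrite big_nat_cond big1 => [|j /andP[hj _]]; last first.
  by rewrite bin_small ?Rmult_0_l //; lia.
rewrite Rplus_0_l -{2}[s]add0n big_addn (_ : (r + s).+1 - s = r.+1)%N; last by lia.
rewrite dpowD big_distrl /=; apply: eq_big_nat => l hl.
rewrite INR_binomial; last by lia.
rewrite (_ : r + s - (l + s) = r - l)%N; last by lia.
rewrite (_ : l + s - s = l)%N; last by lia.
rewrite /dpow pow_add.
have := INR_fact_neq_0 (r - l); have := INR_fact_neq_0 l; have := INR_fact_neq_0 s.
have := INR_fact_neq_0 (l + s).
by move=> *; field.
Qed.

Lemma rphiS r u : rphi r.+1 u = ((-1) ^ r.+1 * dpow r (INR u))%R.
Proof. by rewrite /rphi subn1. Qed.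

Lemma rphi_shuffle r s u v : (0 < r)%N -> (0 < s)%N ->
  (rphi r (u + v) * rphi s u =
   \rsum_(1 <= i < r + s) INR 'C(i - 1, s - 1) * (rphi i u * rphi (r + s - i) v))%R.
Proof.
case: r s => // r [] // s _ _; rewrite !rphiS addnS addSn subn1 big_add1.
transitivity ((-1) ^ (r + s) * (dpow r (INR u + INR v) * dpow s (INR u)))%R.
  by rewrite -[(u + v)%N]/(Nat.add u v) plus_INR -[(r + s)%N]/(Nat.add r s) pow_add /=; ring.
rewrite dpow_shuffle big_distrr; apply: eq_big_nat => i hi.
rewrite subn1 (_ : (r + s).+2 - i.+1 = (r + s - i).+1)%N; last by lia.
rewrite !rphiS {1}(_ : r + s = i + (r + s - i))%N; last by lia.
by rewrite -[(i + _)%N]/(Nat.add i (r + s - i)) pow_add /=; ring.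
Qed.

Lemma rphi_diag r s u : (0 < r)%N -> (0 < s)%N ->
  (rphi r u * rphi s u = - (INR 'C(r + s - 2, r - 1) * rphi (r + s - 1) u))%R.
Proof.
case: r s => // r [] // s _ _; rewrite addnS addSn !subn1 subn2 !rphiS.
rewrite INR_binomial; last by lia.
rewrite (_ : (r + s).+2.-2 - r.+1.-1 = s)%N; last by lia.
rewrite /dpow /= -[(r + s)%N]/(Nat.add r s) !pow_add.
have := INR_fact_neq_0 r; have := INR_fact_neq_0 s; have := INR_fact_neq_0 (Nat.add r s).
by move=> *; field.
Qed.

(** * Convergence and decay of the series [Phi] *)

Lemma ex_series_pow_geom d rho : (0 <= rho < 1)%R ->
  ex_series (fun n => INR n.+1 ^ d * rho ^ n)%R.
Proof.
(* The ratio test needs nonzero terms, and [rho] may be [0]; the comparison series has ratio [t]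
   strictly between [0] and [1]. *)
move=> hr; pose t := ((1 + rho) / 2)%R.
apply: (@ex_series_le R_AbsRing R_CompleteNormedModule _ (fun n => INR n.+1 ^ d * t ^ n)%R).
  move=> n; rewrite -[norm _]/(Rabs _) Rabs_pos_eq.
    apply: Rmult_le_compat_l; first by apply: pow_le; apply: pos_INR.
    by apply: pow_incr; rewrite /t; lra.
  by apply: Rmult_le_pos; apply: pow_le; [exact: pos_INR|lra].
have ht : (0 < t < 1)%R by rewrite /t; lra.
have hp n : (0 < INR n.+1 ^ d * t ^ n)%R.
  by apply: Rmult_lt_0_compat; apply: pow_lt; [apply: lt_0_INR; lia|lra].
apply: (ex_series_ext (fun n => Rabs (INR n.+1 ^ d * t ^ n))) => [n|].
  by rewrite Rabs_pos_eq //; apply: Rlt_le.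
apply: (ex_series_DAlembert _ t); [lra| |].
  by move=> n; have := hp n; lra.
have h1 : is_lim_seq (fun n => 1 + / INR n.+1)%R 1%R.
  rewrite -{2}[1%R]Rplus_0_r; apply: is_lim_seq_plus'; first exact: is_lim_seq_const.
  have := is_lim_seq_inv _ _ (proj1 (is_lim_seq_incr_1 _ _) is_lim_seq_INR).
  by apply.
have h2 : is_lim_seq (fun n => (1 + / INR n.+1) ^ d)%R 1%R.
  elim: d {hp} => [|d IH]; first exact: is_lim_seq_const.
  by rewrite -[1%R](Rmult_1_l 1); apply: is_lim_seq_mult'; rewrite ?Rmult_1_l.
have ht1 := is_lim_seq_mult' _ _ _ _ h2 (is_lim_seq_const t); rewrite Rmult_1_l in ht1.
apply: is_lim_seq_ext ht1 => n.
have h0 : (0 < INR n.+1)%R by apply: lt_0_INR; lia.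
rewrite Rabs_pos_eq; last first.
  apply: Rlt_le; by apply: Rdiv_lt_0_compat; [exact: (hp n.+1)|exact: (hp n)].
rewrite (_ : 1 + / INR n.+1 = INR n.+2 * / INR n.+1)%R; last first.
  by rewrite (S_INR n.+1); field; lra.
rewrite Rpow_mult_distr pow_inv -tech_pow_Rmult.
have e1 : (t ^ n <> 0)%R by apply: pow_nonzero; lra.
have e2 : (INR n.+1 ^ d <> 0)%R by apply: pow_nonzero; lra.
by field.
Qed.

Lemma Cmod_RtoC_pos x : (0 <= x)%R -> Cmod (RtoC x) = x.
Proof. by move=> h; rewrite Cmod_R Rabs_pos_eq. Qed.

Lemma Rabs_rphi r u : Rabs (rphi r u) = (INR u ^ (r - 1) / INR (fact (r - 1)))%R.
Proof.
rewrite /rphi Rabs_mult -RPow_abs Rabs_Ropp Rabs_R1 pow1 Rmult_1_l Rabs_pos_eq //.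
apply: Rdiv_le_0_compat; first by apply: pow_le; apply: pos_INR.
exact: INR_fact_lt_0.
Qed.

Lemma ex_series_rphi r rho : (0 <= rho < 1)%R ->
  ex_series (fun n => Rabs (rphi r n.+1) * rho ^ n)%R.
Proof.
move=> h; apply: ex_series_ext (ex_series_scal_l (/ INR (fact (r - 1)))%R _
  (ex_series_pow_geom (r - 1) h)) => n.
by rewrite Rabs_rphi /scal /= /mult /=; field; apply: INR_fact_neq_0.
Qed.

Lemma Cmod_aphi r x u : Cmod (aphi r x u) = (Rabs (rphi r u) * Cmod x ^ u)%R.
Proof. by rewrite /aphi Cmod_mult Cmod_R Cmod_pow. Qed.

Lemma pabs_aphi r x : (Cmod x < 1)%R -> pabs (aphi r x).
Proof.
move=> h; have h0 := Cmod_ge_0 x.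
apply: (pabs_le (b := fun n => Rabs (rphi r n.+1) * Cmod x ^ n)%R).
  move=> n; rewrite Cmod_aphi; apply: Rmult_le_compat_l; first exact: Rabs_pos.
  by rewrite -tech_pow_Rmult; have := pow_le _ n h0; nra.
exact: ex_series_rphi.
Qed.

Lemma psum_aphi r x : (Cmod x < 1)%R -> psum (aphi r x) (Phi r x).
Proof. by move=> h; apply: pabs_psum; apply: pabs_aphi. Qed.

(** The constant does not depend on [m], which makes sums over [m] converge. As [m >= 1], one has
    [m (n + 1) >= m + n], so [rho ^ m] comes out of every term and a fixed series remains. The
    factor 2 comes from bounding real and imaginary parts separately. *)
Lemma Phi_bound r rho : (0 <= rho < 1)%R -> exists K : R,
  forall q m, Cmod q = rho -> (0 < m)%N -> (Cmod (Phi r (Cpow q m)) <= K * rho ^ m)%R.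
Proof.
move=> h; exists (2 * Series (fun n => Rabs (rphi r n.+1) * rho ^ n))%R => q m hq hm.
pose c n := (rho ^ m * (Rabs (rphi r n.+1) * rho ^ n))%R.
have hc : ex_series c by apply: ex_series_scal_l; apply: ex_series_rphi.
have hle n : (Cmod (aphi r (Cpow q m) n.+1) <= c n)%R.
  rewrite Cmod_aphi Cmod_pow hq -pow_mult /c.
  rewrite -Rmult_assoc [(_ ^ m * _)%R]Rmult_comm Rmult_assoc -pow_add.
  apply: Rmult_le_compat_l; first exact: Rabs_pos.
  have [k ->] : exists k, Nat.mul m n.+1 = Nat.add (Nat.add m n) k.
    exists (m * n.+1 - (m + n))%N; nia.
  rewrite [X in (X <= _)%R]pow_add -[X in (_ <= X)%R]Rmult_1_r.
  apply: Rmult_le_compat_l; first by apply: pow_le; lra.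
  by rewrite -(pow1 k); apply: pow_incr; lra.
have hS (f : C -> R) : (forall z, Rabs (f z) <= Cmod z)%R ->
    (Rabs (Series (fun n => f (aphi r (Cpow q m) n.+1))) <= Series c)%R.
  move=> hf.
  have hd n : (0 <= Rabs (f (aphi r (Cpow q m) n.+1)) <= c n)%R.
    by split; [exact: Rabs_pos|exact: Rle_trans (hf _) (hle n)].
  apply: Rle_trans (Series_Rabs _ _) (Series_le _ _ hd hc).
  apply: ex_series_le hc => n; rewrite /norm /= /abs /= Rabs_Rabsolu.
  by case: (hd n).
have := hS Re (fun z => Rle_trans _ _ _ (Rmax_l _ _) (Rmax_Cmod z)).
have := hS Im (fun z => Rle_trans _ _ _ (Rmax_r _ _) (Rmax_Cmod z)).
rewrite (Series_scal_l (rho ^ m)) => h1 h2.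
apply: Rle_trans (_ : (Rabs (Re (Phi r (q ^ m))) + Rabs (Im (Phi r (q ^ m))) <= _)%R).
  rewrite [X in Cmod X](_ : _ = RtoC (Re (Phi r (q ^ m))) + Ci * RtoC (Im (Phi r (q ^ m)))); last first.
    by rewrite /Cplus /Cmult /=; apply: injective_projections => /=; ring.
  apply: Rle_trans (Cmod_triangle _ _) _.
  rewrite Cmod_mult !Cmod_R (_ : Cmod Ci = 1%R) ?Rmult_1_l; first exact: Rle_refl.
  by rewrite /Cmod /= (_ : 0 * (0 * 1) + 1 * (1 * 1) = 1)%R ?sqrt_1 //; ring.
rewrite -[Re (Phi _ _)]/(Series _) -[Im (Phi _ _)]/(Series _); lra.
Qed.

(** With [v = N - u] one has [x^N y^u = (x y)^u x^v], and [rphi_shuffle] separates the coefficients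
    in the same variables [u] and [v]. *)
Lemma aphi_half r s x y N : (0 < r)%N -> (0 < s)%N ->
  \csum_(1 <= u < N) aphi r x N * aphi s y u =
  \csum_(1 <= i < r + s) (binC (i - 1) (s - 1) *
    \csum_(1 <= u < N) aphi i (x * y) u * aphi (r + s - i) x (N - u)%N).
Proof.
move=> hr hs.
under [RHS]eq_bigr => i _ do rewrite big_distrr /=.
rewrite exchange_big /=; apply: eq_big_nat => u hu.
have -> : N = (u + (N - u))%N by lia.
set v := (N - u)%N; rewrite addKn.
transitivity (RtoC (rphi r (u + v) * rphi s u) * (Cpow (x * y) u * Cpow x v)).
  rewrite /aphi RtoC_mult Cpow_mult_l -[(u + v)%N]/(Nat.add u v) Cpow_add_r; ring.
rewrite rphi_shuffle // csum_RtoC big_distrl /=; apply: eq_bigr => i _.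
by rewrite /aphi !RtoC_mult /binC; ring.
Qed.

(** The half where the index of [x] is larger gives the first sum, the other half the second with
    [x] and [y] exchanged. On the diagonal [x^u y^u] merges into a single series, whose weight is
    one lower; this lowering is also what makes its sign negative. *)
Lemma Phi_shuffle r s x y : (0 < r)%N -> (0 < s)%N ->
  (Cmod x < 1)%R -> (Cmod y < 1)%R ->
  Phi r x * Phi s y =
  \csum_(1 <= i < r + s) (binC (i - 1) (s - 1) * (Phi i (x * y) * Phi (r + s - i) x))
  + \csum_(1 <= i < r + s) (binC (i - 1) (r - 1) * (Phi i (x * y) * Phi (r + s - i) y))
  - binC (r + s - 2) (r - 1) * Phi (r + s - 1) (x * y).
Proof.
move=> hr hs hx hy.
have hxy : (Cmod (x * y) < 1)%R.
  rewrite Cmod_mult; have := Cmod_ge_0 x; have := Cmod_ge_0 y; nra.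
apply: (clim_unique (psum_square (psum_aphi r hx) (psum_aphi s hy))).
have half r' s' x' y' : (0 < r')%N -> (0 < s')%N -> (Cmod x' < 1)%R ->
    (Cmod (x' * y') < 1)%R ->
    psum (fun N => \csum_(1 <= u < N) aphi r' x' N * aphi s' y' u)
     (\csum_(1 <= i < r' + s') (binC (i - 1) (s' - 1) *
        (Phi i (x' * y') * Phi (r' + s' - i) x'))).
  move=> hr' hs' hx' hxy'; apply: psum_ext (fun N _ => esym (aphi_half x' y' N hr' hs')) _.
  apply: psum_csum => i _; apply: psum_scal.
  by apply: psum_cauchy; try apply: pabs_aphi; try apply: psum_aphi.
have h1 := half r s x y hr hs hx hxy.
have hyx : (Cmod (y * x) < 1)%R by rewrite Cmult_comm.
have h2 := half s r y x hs hr hy hyx.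
have h3 := psum_scal (- binC (r + s - 2) (r - 1)) (psum_aphi (r + s - 1) hxy).
rewrite (Cmult_comm y x) addnC in h2.
rewrite /Cminus (_ : forall a b, - (a * b) = (- a) * b); last by move=> *; ring.
apply: clim_ext (clim_plus (clim_plus h1 h2) h3) => n.
rewrite big_square_split /=; congr (_ + _ + _).
  by apply: eq_bigr => u _; apply: eq_bigr => v _; ring.
apply: eq_bigr => u _; rewrite /aphi Cpow_mult_l /binC.
transitivity (RtoC (rphi r u * rphi s u) * (Cpow x u * Cpow y u)).
  by rewrite rphi_diag // RtoC_opp !RtoC_mult; ring.
by rewrite RtoC_mult; ring.
Qed.

(** * Sums over the multiples of tau *)

Lemma sum_n_m_csum (f : nat -> C) n : sum_n_m f 1 n = \csum_(1 <= i < n.+1) f i.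
Proof.
elim: n => [|n IH]; first by rewrite sum_n_m_zero ?big_geq //; lia.
by rewrite sum_n_Sm ?IH ?[RHS]big_nat_recr //; lia.
Qed.

Lemma CSeries_ext a b : (forall n, a n = b n) -> CSeries a = CSeries b.
Proof. by move=> H; rewrite /CSeries; congr pair; apply: Series_ext => n; rewrite H. Qed.

(** Terms outside [p] are set to zero instead of being skipped, so a sum restricted by parity stays
    an ordinary series to which Cauchy products and square splittings apply. *)
Definition sel (p : nat -> bool) (a : nat -> C) (m : nat) : C :=
  if p m then a m else RtoC 0.

Lemma psum_sum_pos p a b : (forall m, (0 < m)%N -> a m = b m) ->
  pabs (sel p b) -> psum (sel p b) (sum_pos p a).
Proof.
move=> E /pabs_psum H; rewrite /sum_pos; move: H; congr psum.
by apply: CSeries_ext => n; rewrite /sel E.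
Qed.

Lemma Cexp_plus z w : Cexp (z + w) = Cexp z * Cexp w.
Proof.
by rewrite /Cexp /Re /Im; apply: injective_projections; rewrite /= exp_plus ?cos_plus ?sin_plus; ring.
Qed.

Lemma Cexp_INR m z : Cexp (RtoC (INR m) * z) = Cpow (Cexp z) m.
Proof.
elim: m => [|m IH].
  by rewrite Cmult_0_l /Cexp /= exp_0 cos_0 sin_0; apply: injective_projections => /=; ring.
by rewrite S_INR RtoC_plus Cmult_plus_distr_r Cexp_plus IH Cpow_S Cmult_1_l Cmult_comm.
Qed.

Lemma Cmod_Cexp z : Cmod (Cexp z) = exp (Re z).
Proof.
rewrite /Cmod /Cexp /= (_ : forall a b c, a * b * (a * b * 1) + a * c * (a * c * 1) =
  Rsqr a * (Rsqr c + Rsqr b))%R; last by rewrite /Rsqr => *; ring.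
by rewrite sin2_cos2 Rmult_1_r sqrt_Rsqr //; apply: Rlt_le; apply: exp_pos.
Qed.

Lemma qexp_INR m tau : qexp (RtoC (INR m) * tau) = Cpow (qexp tau) m.
Proof. by rewrite /qexp -Cexp_INR; congr Cexp; ring. Qed.

Lemma Cmod_qexp tau : (0 < Im tau)%R -> (Cmod (qexp tau) < 1)%R.
Proof.
move=> h; rewrite /qexp Cmod_Cexp -exp_0; apply: exp_increasing.
rewrite /twopii /Ci /=; have := PI_RGT_0; case: tau h => a b /=; nra.
Qed.

Lemma Cmod_Cpow_lt1 q m : (Cmod q < 1)%R -> (0 < m)%N -> (Cmod (Cpow q m) < 1)%R.
Proof.
case: m => // m h _; rewrite Cmod_pow -tech_pow_Rmult; have h0 := Cmod_ge_0 q.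
have : (Cmod q ^ m <= 1)%R by rewrite -(pow1 m); apply: pow_incr; lra.
have := pow_le _ m h0; nra.
Qed.

Lemma phim_Phi k m tau : (0 < Im tau)%R -> (0 < m)%N ->
  phim k m tau = Phi k (Cpow (qexp tau) m).
Proof.
move=> h hm; rewrite /phim /phi qexp_INR minusE; set x := Cpow _ m.
have hx : (Cmod x < 1)%R by apply: Cmod_Cpow_lt1 => //; apply: Cmod_qexp.
set c := sgnC k / _.
have f0 : ((-1) ^ k <> 0)%R by apply: pow_nonzero; lra.
have f1 := INR_fact_neq_0 (k - 1).
have E u : (/ c) * aphi k x u = RtoC (INR u ^ (k - 1)) * Cpow x u.
  rewrite /aphi /c /rphi /dpow /sgnC -RtoC_pow -RtoC_div // -RtoC_inv; last first.
    by apply: Rmult_integral_contrapositive; split=> //; apply: Rinv_neq_0_compat.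
  by rewrite Cmult_assoc -RtoC_mult; congr (RtoC _ * _); field.
have c0 : c <> RtoC 0.
  rewrite /c /sgnC -RtoC_pow -RtoC_div //; case.
  apply: Rmult_integral_contrapositive; split=> //; exact: Rinv_neq_0_compat.
rewrite /sum_pos.
rewrite (psum_CSeries (psum_ext (fun u _ => E u) (psum_scal (/ c) (psum_aphi k hx)))).
by rewrite Cmult_assoc Cinv_r // Cmult_1_l.
Qed.

Section Fixed_q.
Variables (q : C) (hq : (Cmod q < 1)%R).
Let P (r m : nat) : C := Phi r (Cpow q m).

Lemma Cmod_q_range : (0 <= Cmod q < 1)%R. Proof. by split; [exact: Cmod_ge_0|]. Qed.

(** Weight [1] serves [fo] and [fe], weight [m] serves [fbaro] and [fbare]; the geometric decay from
    [Phi_bound] absorbs both. *)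
Lemma pabs_sel_weight p (w : nat -> R) r :
  (forall m, 0 <= w m.+1 <= INR m.+1)%R ->
  pabs (sel p (fun m => RtoC (w m) * P r m)).
Proof.
move=> hw; have [K hK] := Phi_bound r Cmod_q_range.
have K0 : (0 <= K * Cmod q ^ 1)%R.
  by apply: Rle_trans (hK q 1%N _ _) => //; apply: Cmod_ge_0.
apply: (pabs_le (b := fun n => (K * Cmod q ^ 1) * (INR n.+1 ^ 1 * Cmod q ^ n))%R); last first.
  by apply: ex_series_scal_l; apply: ex_series_pow_geom; apply: Cmod_q_range.
move=> n; have hP := hK q n.+1 erefl (ltn0Sn n).
have h1 : (0 <= K * Cmod q ^ n.+1)%R by apply: Rle_trans hP; apply: Cmod_ge_0.
have E : (K * Cmod q ^ 1 * (INR n.+1 ^ 1 * Cmod q ^ n) = INR n.+1 * (K * Cmod q ^ n.+1))%R.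
  by rewrite -(tech_pow_Rmult _ n); ring.
have hn : (0 <= INR n.+1)%R by apply: pos_INR.
rewrite E /sel; case: ifP => _; last first.
  by rewrite Cmod_0; apply: Rmult_le_pos.
rewrite Cmod_mult Cmod_RtoC_pos; last by case: (hw n).
by apply: Rmult_le_compat; [case: (hw n)|exact: Cmod_ge_0|case: (hw n)|].
Qed.

Lemma pabs_ext a b : (forall m, (0 < m)%N -> a m = b m) -> pabs a -> pabs b.
Proof. by move=> E; apply: ex_series_ext => n; rewrite E. Qed.

Lemma pabs_sel_P p r : pabs (sel p (P r)).
Proof.
apply: pabs_ext (pabs_sel_weight p (w := fun _ => 1%R) r _) => [m _|m].
  by rewrite /sel Cmult_1_l.
by rewrite S_INR; have := pos_INR m; lra.
Qed.

Definition Dterm (p p' : nat -> bool) r s : nat -> C :=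
  sel p (fun m => \csum_(1 <= v < m) sel p' (fun v => P r m * P s v) v).

Lemma Dterm_sel p p' r s m :
  Dterm p p' r s m = \csum_(1 <= v < m) sel p (P r) m * sel p' (P s) v.
Proof.
rewrite /Dterm /sel; case: (p m); last by rewrite big1 // => v _; rewrite Cmult_0_l.
by apply: eq_bigr => v _; case: (p' v) => //; rewrite Cmult_0_r.
Qed.

(** The inner sums are bounded by the full absolute sum [S], uniformly in the outer index. *)
Lemma pabs_Dterm p p' r s : pabs (Dterm p p' r s).
Proof.
have [S hS] := pabs_sel_P p' s.
move/(is_series_rsum (fun v => Cmod (sel p' (P s) v))): hS => hS.
have hB n : (\rsum_(1 <= v < n.+1) Cmod (sel p' (P s) v) <= S)%R.
  apply: (is_lim_seq_incr_compare _ _ hS) => {}n.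
  by rewrite [X in (_ <= X)%R]big_nat_recr //=; have := Cmod_ge_0 (sel p' (P s) n.+1); lra.
apply: (pabs_le (b := fun n => Cmod (sel p (P r) n.+1) * S)%R); last first.
  by apply: ex_series_scal_r; apply: pabs_sel_P.
move=> n; rewrite Dterm_sel -big_distrr /= Cmod_mult.
apply: Rmult_le_compat_l; first exact: Cmod_ge_0.
exact: Rle_trans (Cmod_csum_le _ _ _) (hB n).
Qed.

Lemma psum_stuffle p p' r s A B D D' E :
  psum (sel p (P r)) A -> psum (sel p' (P s)) B ->
  psum (Dterm p p' r s) D -> psum (Dterm p' p s r) D' ->
  psum (fun m => sel p (P r) m * sel p' (P s) m) E ->
  A * B = D + D' + E.
Proof.
move=> hA hB hD hD' hE; apply: (clim_unique (psum_square hA hB)).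
apply: clim_ext (clim_plus (clim_plus hD hD') hE) => n.
rewrite big_square_split /=; congr (_ + _ + _); apply: eq_bigr => u _.
  by rewrite Dterm_sel.
by rewrite Dterm_sel; apply: eq_bigr => v _; rewrite Cmult_comm.
Qed.

(** Apply [Phi_shuffle] with [x = q^u] and [y = q^(N - u)], so that [x y = q^N]. The two hypotheses
    say that, once [N] satisfies [pN], the conditions on [u] and on [N - u] are equivalent; each sum
    then needs only the condition on the index it keeps. The last term does not involve [u] and is
    multiplied by the number of admissible [u]. *)
Lemma conv_shuffle p p' pN r s N : (0 < r)%N -> (0 < s)%N ->
  (forall u, (0 < u < N)%N -> p u && p' (N - u)%N = pN N && p u) ->
  (forall u, (0 < u < N)%N -> pN N && p u = pN N && p' (N - u)%N) ->
  \csum_(1 <= u < N) sel p (P r) u * sel p' (P s) (N - u)%N =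
  \csum_(1 <= i < r + s) binC (i - 1) (s - 1) * Dterm pN p i (r + s - i) N
  + \csum_(1 <= i < r + s) binC (i - 1) (r - 1) * Dterm pN p' i (r + s - i) N
  + (- binC (r + s - 2) (r - 1)) *
    sel pN (fun N => RtoC (\rsum_(1 <= u < N) if p u then 1 else 0) * P (r + s - 1) N) N.
Proof.
move=> hr hs H1 H2.
transitivity (\csum_(1 <= u < N) if pN N && p u then P r u * P s (N - u)%N else RtoC 0).
  apply: eq_big_nat => u hu; rewrite -H1 // /sel.
  by case: (p u); case: (p' _) => //=; ring.
rewrite /Dterm /sel; case: (pN N) H2 => /= H2; last first.
  by rewrite !big1 ?Cmult_0_r ?Cplus_0_l // => i _; rewrite ?Cmult_0_r.
transitivity (\csum_(1 <= u < N) if p u then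
   (\csum_(1 <= i < r + s) (binC (i - 1) (s - 1) * (P i N * P (r + s - i) u))
  + \csum_(1 <= i < r + s) (binC (i - 1) (r - 1) * (P i N * P (r + s - i) (N - u)%N))
  - binC (r + s - 2) (r - 1) * P (r + s - 1) N) else RtoC 0).
  apply: eq_big_nat => u hu; case: (p u) => //.
  rewrite /P; have -> : Cpow q N = Cpow q u * Cpow q (N - u).
    by rewrite -Cpow_add_r; congr Cpow; lia.
  by apply: Phi_shuffle => //; apply: Cmod_Cpow_lt1 => //; lia.
transitivity
  (\csum_(1 <= u < N) \csum_(1 <= i < r + s)
     (binC (i - 1) (s - 1) * (if p u then P i N * P (r + s - i) u else RtoC 0))
  + \csum_(1 <= u < N) \csum_(1 <= i < r + s)
     (binC (i - 1) (r - 1) * (if p' (N - u)%N then P i N * P (r + s - i) (N - u)%N else RtoC 0))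
  + \csum_(1 <= u < N) (- binC (r + s - 2) (r - 1) * (RtoC (if p u then 1 else 0)%R * P (r + s - 1) N))).
  rewrite -!big_split /=; apply: eq_big_nat => u hu; rewrite -H2 //.
  case: (p u); first by rewrite /Cminus Cmult_1_l; congr (_ + _ + _); ring.
  rewrite Cmult_0_l Cmult_0_r big1; last by move=> i _; rewrite Cmult_0_r.
  by rewrite big1; [ring|move=> i _; rewrite Cmult_0_r].
congr (_ + _ + _).
- by rewrite exchange_big /=; apply: eq_bigr => i _; rewrite big_distrr.
- rewrite exchange_big /=; apply: eq_bigr => i _; rewrite big_distrr /=.
  rewrite [RHS]big_nat_rev /=; apply: eq_big_nat => u hu.
  by rewrite (_ : 1 + N - u.+1 = N - u)%N //; lia.
- by rewrite -big_distrr /= -big_distrl /= csum_RtoC.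
Qed.

End Fixed_q.

(** * Even zeta values *)

(* Matsuoka's integrals: [J n / I n] telescopes with differences [1 / (2 n^2)]. *)
Definition cosI (n : nat) : R := RInt (fun x => cos x ^ (2 * n))%R 0 (PI / 2).
Definition cosJ (n : nat) : R := RInt (fun x => x ^ 2 * cos x ^ (2 * n))%R 0 (PI / 2).

Lemma is_RInt_cosI n : is_RInt (fun x => cos x ^ (2 * n))%R 0 (PI / 2) (cosI n).
Proof.
apply: RInt_correct; apply: ex_RInt_continuous => x _.
by apply: ex_derive_continuous; auto_derive.
Qed.

Lemma is_RInt_cosJ n : is_RInt (fun x => x ^ 2 * cos x ^ (2 * n))%R 0 (PI / 2) (cosJ n).
Proof.
apply: RInt_correct; apply: ex_RInt_continuous => x _.
by apply: ex_derive_continuous; auto_derive.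
Qed.

Lemma is_RInt_R_unique (f : R -> R) a b (l l' : R) : is_RInt f a b l -> is_RInt f a b l' -> l = l'.
Proof. by move=> h1 h2; rewrite -(is_RInt_unique _ _ _ _ h1) (is_RInt_unique _ _ _ _ h2). Qed.

Lemma cosI_rec m : (INR (2 * m).+2 * cosI m.+1 = INR (2 * m).+1 * cosI m)%R.
Proof.
pose F x := (cos x ^ (2 * m).+1 * sin x)%R.
pose F' x := (INR (2 * m).+2 * cos x ^ (2 * m.+1) - INR (2 * m).+1 * cos x ^ (2 * m))%R.
have h1 : is_RInt F' 0 (PI / 2) (F (PI / 2) - F 0)%R.
  apply: is_RInt_derive => x _; last first.
    by apply: ex_derive_continuous; rewrite /F'; auto_derive.
  rewrite /F /F' (_ : (2 * m.+1 = (2 * m).+2)%N); last by lia.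
  move: (2 * m)%N => k; auto_derive => //.
  rewrite -/(INR k.+1) -/(INR k.+2) (S_INR k.+1) -!tech_pow_Rmult.
  have e := sin2_cos2 x; apply: Rminus_diag_uniq.
  transitivity (INR k.+1 * cos x ^ k * (1 - (Rsqr (sin x) + Rsqr (cos x))))%R.
    by rewrite /Rsqr; ring.
  by rewrite e; ring.
have h2 : is_RInt F' 0 (PI / 2) (INR (2 * m).+2 * cosI m.+1 - INR (2 * m).+1 * cosI m)%R.
  by apply: is_RInt_minus; apply: is_RInt_scal; apply: is_RInt_cosI.
have := is_RInt_R_unique h1 h2.
rewrite /F cos_PI2 sin_0 -tech_pow_Rmult; lra.
Qed.

(** Two integrations by parts in one: the first summand of [F] is there to cancel the mixed term
    [x cos^(2m+1) x sin x] in the derivative of the second. [F] vanishes at both ends. *)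
Lemma cosJ_rec m :
  (cosI m.+1 + INR (2 * m).+2 / 2 * (INR (2 * m).+2 * cosJ m.+1 - INR (2 * m).+1 * cosJ m) = 0)%R.
Proof.
pose F x := (x * cos x ^ (2 * m).+2 + INR (2 * m).+2 / 2 * (x ^ 2 * (cos x ^ (2 * m).+1 * sin x)))%R.
pose F' x := (cos x ^ (2 * m.+1) + INR (2 * m).+2 / 2 *
  (INR (2 * m).+2 * (x ^ 2 * cos x ^ (2 * m.+1)) - INR (2 * m).+1 * (x ^ 2 * cos x ^ (2 * m))))%R.
have h1 : is_RInt F' 0 (PI / 2) (F (PI / 2) - F 0)%R.
  apply: is_RInt_derive => x _; last first.
    by apply: ex_derive_continuous; rewrite /F'; auto_derive.
  rewrite /F /F' (_ : (2 * m.+1 = (2 * m).+2)%N); last by lia.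
  move: (2 * m)%N => k; auto_derive => //.
  rewrite -/(INR k.+1) -/(INR k.+2) (S_INR k.+1) -!tech_pow_Rmult.
  have e := sin2_cos2 x; apply: Rminus_diag_uniq.
  transitivity ((INR k.+1 + 1) / 2 * x ^ 2 * (INR k.+1 * cos x ^ k) * (1 - (Rsqr (sin x) + Rsqr (cos x))))%R.
    by rewrite /Rsqr; field.
  by rewrite e; ring.
have h2 : is_RInt F' 0 (PI / 2)
    (cosI m.+1 + INR (2 * m).+2 / 2 * (INR (2 * m).+2 * cosJ m.+1 - INR (2 * m).+1 * cosJ m))%R.
  apply: is_RInt_plus; first exact: is_RInt_cosI.
  by apply: is_RInt_scal; apply: is_RInt_minus; apply: is_RInt_scal; apply: is_RInt_cosJ.
rewrite -(is_RInt_R_unique h1 h2) /F cos_PI2 sin_0 -!tech_pow_Rmult; lra.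
Qed.

Lemma sin_ge_xcos x : (0 <= x <= PI / 2)%R -> (x * cos x <= sin x)%R.
Proof.
move=> [h0 h1].
have [||c []] := MVT_gen (fun t => sin t - t * cos t)%R 0 x (fun t => t * sin t)%R.
- by move=> t _; auto_derive => //; ring.
- move=> t _; apply/continuity_pt_filterlim.
  by apply (ex_derive_continuous (fun t => sin t - t * cos t)%R t); auto_derive.
rewrite Rmin_left // Rmax_right // => hc.
have hs : (0 <= sin c)%R by apply: sin_ge_0; lra.
have : (0 <= c * sin c * (x - 0))%R by do 2?[apply: Rmult_le_pos; try lra].
by rewrite sin_0; lra.
Qed.

Lemma cosI_pos m : (0 < cosI m)%R.
Proof.
elim: m => [|m IH].
  have h1 : is_RInt (fun x => cos x ^ (2 * 0))%R 0 (PI / 2) (scal (PI / 2 - 0) 1)%R.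
    by rewrite muln0; apply: is_RInt_const.
  rewrite (is_RInt_R_unique (@is_RInt_cosI 0) h1) /scal /= /mult /=.
  have := PI_RGT_0; lra.
have := cosI_rec m.
have h1 : (0 < INR (2 * m).+2)%R by apply: lt_0_INR; lia.
have h2 : (0 < INR (2 * m).+1)%R by apply: lt_0_INR; lia.
by nra.
Qed.

Lemma cosJ_ge0 m : (0 <= cosJ m)%R.
Proof.
apply: (is_RInt_le (fun _ => 0%R) _ 0 (PI / 2) _ _ _ _ (@is_RInt_cosJ m)).
- have := PI_RGT_0; lra.
- have := is_RInt_const 0 (PI / 2) (0%R : R_NormedModule).
  by rewrite /scal /= /mult /= Rmult_0_r.
- move=> x _; apply: Rmult_le_pos; first exact: pow2_ge_0.
  by rewrite -[(2 * m)%N]/(Nat.mul 2 m) pow_mult; apply: pow_le; exact: pow2_ge_0.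
Qed.

(** Square [x cos x <= sin x] and multiply by [cos^(2m) x]. By [cosI_rec] the right side equals
    [cosI m.+1 / (2m + 1)], which forces [cosJ / cosI] to zero. *)
Lemma cosJ_le m : (cosJ m.+1 <= cosI m - cosI m.+1)%R.
Proof.
apply: (is_RInt_le (fun x => x ^ 2 * cos x ^ (2 * m.+1))%R
  (fun x => cos x ^ (2 * m) - cos x ^ (2 * m.+1))%R 0 (PI / 2)).
- have := PI_RGT_0; lra.
- exact: is_RInt_cosJ.
- by apply: is_RInt_minus; apply: is_RInt_cosI.
move=> x hx; rewrite (_ : (2 * m.+1 = (2 * m).+2)%N); last by lia.
rewrite -!tech_pow_Rmult.
have h0 : (0 <= cos x ^ (2 * m))%R.
  by rewrite -[(2 * m)%N]/(Nat.mul 2 m) pow_mult; apply: pow_le; exact: pow2_ge_0.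
have hs : (x * cos x <= sin x)%R by apply: sin_ge_xcos; lra.
have hc : (0 <= cos x)%R by apply: cos_ge_0; lra.
have e := sin2_cos2 x; rewrite /Rsqr in e.
have h1 : ((x * cos x) * (x * cos x) <= sin x * sin x)%R.
  by apply: Rmult_le_compat => //; apply: Rmult_le_pos; lra.
have := Rmult_le_compat_r _ _ _ h0 h1.
rewrite (_ : sin x * sin x = 1 - cos x * cos x)%R; lra.
Qed.

Definition zN (k N : nat) : R := \rsum_(1 <= a < N.+1) (/ INR a) ^ k.

(** The constant [PI ^ 2 / 6] is [2 * (cosJ 0 / cosI 0)], where both integrals are elementary. *)
Lemma zN2 N : zN 2 N = (PI ^ 2 / 6 - 2 * (cosJ N / cosI N))%R.
Proof.
elim: N => [|N IH].
  have h1 : is_RInt (fun x => cos x ^ (2 * 0))%R 0 (PI / 2) (scal (PI / 2 - 0) 1)%R.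
    by rewrite muln0; apply: is_RInt_const.
  have h2 : is_RInt (fun x => x ^ 2 * cos x ^ (2 * 0))%R 0 (PI / 2)
      ((PI / 2) ^ 3 / 3 - 0 ^ 3 / 3)%R.
    apply: (is_RInt_derive (fun x => x ^ 3 / 3)%R) => x _.
      by auto_derive => //; rewrite muln0 /=; field.
    by apply: ex_derive_continuous; auto_derive.
  rewrite /zN big_geq // (is_RInt_R_unique (@is_RInt_cosI 0) h1).
  rewrite (is_RInt_R_unique (@is_RInt_cosJ 0) h2) /scal /= /mult /=.
  by have := PI_RGT_0 => ?; field; lra.
rewrite /zN big_nat_recr //= -/(zN 2 N) IH.
have I0 := cosI_pos N; have I1 := cosI_pos N.+1.
have e1 := cosI_rec N; have e2 := cosJ_rec N.
have n0 : (0 < INR N.+1)%R by apply: lt_0_INR; lia.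
have E2 : INR (2 * N).+2 = (2 * INR N.+1)%R.
  by rewrite -[2%R]/(INR 2) -mult_INR; congr INR; rewrite multE; lia.
rewrite -/(INR N.+1) Rmult_1_r.
have p : (0 < INR (2 * N).+1)%R by apply: lt_0_INR; lia.
rewrite E2 in e1 e2; move: p e1 e2; set t := INR (2 * N).+1 => p e1 e2.
have -> : cosI N = (2 * INR N.+1 * cosI N.+1 / t)%R by rewrite e1; field; lra.
have -> : cosJ N = ((cosI N.+1 + 2 * INR N.+1 ^ 2 * cosJ N.+1) / (INR N.+1 * t))%R.
  apply: (Rmult_eq_reg_l (INR N.+1 * t)); last by nra.
  rewrite (_ : INR N.+1 * t * (_ / _) = cosI N.+1 + 2 * INR N.+1 ^ 2 * cosJ N.+1)%R.
    by lra.
  by field; lra.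
by field; lra.
Qed.

Lemma is_lim_zN2 : is_lim_seq (zN 2) (PI ^ 2 / 6)%R.
Proof.
have h : is_lim_seq (fun N => cosJ N / cosI N)%R 0%R.
  apply/is_lim_seq_incr_1.
  apply: (is_lim_seq_le_le (fun _ => 0%R) _ (fun n => / INR n.+1)%R).
  - move=> n; have I1 := cosI_pos n.+1; have J0 := cosJ_ge0 n.+1; split.
      by apply: Rdiv_le_0_compat.
    have h0 : (0 < INR n.+1)%R by apply: lt_0_INR; lia.
    apply/Rle_div_l; first by lra.
    apply: (Rmult_le_reg_l (INR n.+1)); first by [].
    rewrite -Rmult_assoc Rinv_r ?Rmult_1_l; last by lra.
    have := cosJ_le n; have := cosI_rec n; rewrite !S_INR -[(2 * n)%N]/(Nat.mul 2 n) mult_INR /=.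
    have := pos_INR n; rewrite S_INR in h0; nra.
  - exact: is_lim_seq_const.
  - by have := is_lim_seq_inv _ _ (proj1 (is_lim_seq_incr_1 _ _) is_lim_seq_INR); apply.
apply: (is_lim_seq_ext (fun N => PI ^ 2 / 6 - 2 * (cosJ N / cosI N))%R) => [N|].
  by rewrite zN2.
have := is_lim_seq_minus' _ _ _ _ (is_lim_seq_const (PI ^ 2 / 6)%R)
   (is_lim_seq_mult' _ _ _ _ (is_lim_seq_const 2%R) h).
by rewrite Rmult_0_r Rminus_0_r.
Qed.

Lemma inv_INR_bounds n : (0 < / INR n.+1 <= 1)%R.
Proof.
have h : (1 <= INR n.+1)%R by rewrite S_INR; have := pos_INR n; lra.
split; first by apply: Rinv_0_lt_compat; lra.
by rewrite -Rinv_1; apply: Rinv_le_contravar; lra.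
Qed.

Lemma is_lim_zN k : (2 <= k)%N -> is_lim_seq (zN k) (zeta k).
Proof.
move=> hk; rewrite /zeta.
(* Convergence of the sum of inverse squares is a by-product of its evaluation; higher exponents are
   compared with it. *)
have h2 : ex_series (fun n => (/ INR n.+1) ^ 2)%R.
  by exists (PI ^ 2 / 6)%R; apply/(is_series_rsum (fun n => (/ INR n) ^ 2)%R); exact: is_lim_zN2.
rewrite (_ : Series _ = Series (fun n => (/ INR n.+1) ^ k)%R); last first.
  by apply: Series_ext => n; rewrite pow_inv.
apply/(is_series_rsum (fun n => (/ INR n) ^ k)%R); apply: Series_correct.
apply: ex_series_le h2 => n; rewrite -[norm _]/(Rabs _).
have [b0 b1] := inv_INR_bounds n.
rewrite Rabs_pos_eq; last by apply: pow_le; lra.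
have -> : k = Nat.add 2 (k - 2)%N by lia.
rewrite pow_add -[X in (_ <= X)%R]Rmult_1_r; apply: Rmult_le_compat_l.
  by apply: pow_le; lra.
by rewrite -(pow1 (k - 2)); apply: pow_incr; lra.
Qed.

Lemma zeta2 : zeta 2 = (PI ^ 2 / 6)%R.
Proof.
have h1 := is_lim_seq_unique _ _ (is_lim_zN (leqnn 2)).
by have := is_lim_seq_unique _ _ is_lim_zN2; rewrite h1; case.
Qed.

(** * Euler's quadratic recurrence for the even zeta values *)

Definition harm (n : nat) : R := \rsum_(1 <= j < n.+1) / INR j.

Lemma geom_conv (x y : R) n :
  ((x - y) * (\rsum_(1 <= j < n.+1) x ^ j * y ^ (n.+1 - j)) = x ^ n.+1 * y - x * y ^ n.+1)%R.
Proof.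
elim: n => [|n IH]; first by rewrite big_geq //=; ring.
rewrite big_nat_recr //= Rmult_plus_distr_l.
rewrite (_ : \rsum_(1 <= j < n.+1) x ^ j * y ^ (n.+2 - j) =
   y * (\rsum_(1 <= j < n.+1) x ^ j * y ^ (n.+1 - j)))%R; last first.
  rewrite big_distrr /=; apply: eq_big_nat => j hj.
  by rewrite (_ : n.+2 - j = (n.+1 - j).+1)%N /=; [ring|lia].
rewrite (_ : (x - y) * (y * _) = y * (x ^ n.+1 * y - x * y ^ n.+1))%R; last by rewrite -IH; ring.
by rewrite (_ : n.+2 - n.+1 = 1)%N /=; [ring|lia].
Qed.

Lemma rsum_opp (F : nat -> R) m n (p : pred nat) :
  (\big[Rplus/0%R]_(m <= i < n | p i) (- F i) = - \big[Rplus/0%R]_(m <= i < n | p i) F i)%R.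
Proof. by rewrite (big_morph Ropp Ropp_plus_distr Ropp_0). Qed.

Lemma rsum_const m n (c : R) : (\rsum_(m <= j < n) c = INR (n - m) * c)%R.
Proof.
elim: n => [|n IH]; first by rewrite big_geq //=; ring.
case: (ltnP n m) => hn; first by rewrite big_geq // (_ : n.+1 - m = 0)%N /=; [ring|lia].
by rewrite big_nat_recr //= IH // subSn // S_INR; ring.
Qed.

Lemma sum_inv_sub a N : (0 < a <= N)%N ->
  (\big[Rplus/0%R]_(1 <= b < N.+1 | b != a) / (INR b - INR a) = harm (N - a) - harm (a - 1))%R.
Proof.
move=> h; rewrite (@big_cat_nat _ _ _ a) /=; [|lia|lia].
rewrite Rplus_comm; congr (_ + _)%R.
  rewrite big_ltn_cond; last by lia.
  rewrite eqxx /= -[a.+1]add1n big_addn /harm subSn; last by lia.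
  apply: congr_big_nat => // b hb; first by lia.
  by rewrite -[(b + a)%N]/(Nat.add b a) plus_INR; congr (/ _)%R; ring.
transitivity (\big[Rplus/0%R]_(1 <= b < a) - / INR (a - b))%R.
  apply: congr_big_nat => // b hb; first by lia.
  by rewrite minus_INR; [rewrite -Rinv_opp; congr (/ _)%R; ring|lia].
rewrite (rsum_opp _ _ _ predT); congr (- _)%R.
rewrite /harm (_ : (a - 1).+1 = a); last by lia.
rewrite [RHS]big_nat_rev /=; apply: eq_big_nat => b hb.
by congr (/ INR _)%R; lia.
Qed.

Lemma sum_inv_add a N : (0 < a <= N)%N ->
  (\big[Rplus/0%R]_(1 <= b < N.+1 | b != a) / (INR b + INR a)
   = harm (N + a) - harm a - / (2 * INR a))%R.
Proof.
move=> h.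
have : (\rsum_(1 <= b < N.+1) / (INR b + INR a) = harm (N + a) - harm a)%R.
  rewrite /harm [X in (X - _)%R](@big_cat_nat _ _ _ a.+1) /=; [|lia|lia].
  rewrite (_ : forall x y : R, x + y - x = y)%R; last by move=> *; ring.
  rewrite -[a.+1]add1n big_addn (_ : (N + a).+1 - a = N.+1)%N; last by lia.
  apply: eq_big_nat => b hb.
  by rewrite -[(b + a)%N]/(Nat.add b a) plus_INR.
rewrite (bigD1_seq a) ?iota_uniq ?mem_index_iota //=.
by move=> <-; rewrite (_ : INR a + INR a = 2 * INR a)%R; ring.
Qed.

(** Partial fractions with prefactor [1 / (2a)]. The [3 / 4] collects [1 / a] from
    [harm a - harm (a - 1)] and [1 / (2a)] from the excluded [b = a]. *)
Lemma sum_inv_sqr_sub a N : (0 < a <= N)%N ->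
  (\big[Rplus/0%R]_(1 <= b < N.+1 | b != a) / (INR b ^ 2 - INR a ^ 2)
   = 3 / 4 * (/ INR a) ^ 2 - / 2 * / INR a * (harm (N + a) - harm (N - a)))%R.
Proof.
move=> h; have a0 : (0 < INR a)%R by apply: lt_0_INR; lia.
transitivity (/ (2 * INR a) *
   (\big[Rplus/0%R]_(1 <= b < N.+1 | b != a) / (INR b - INR a)
    - \big[Rplus/0%R]_(1 <= b < N.+1 | b != a) / (INR b + INR a)))%R.
  rewrite /Rminus -(rsum_opp _ _ _ (fun b => b != a)) -big_split /= big_distrr /=.
  rewrite big_nat_cond [RHS]big_nat_cond; apply: eq_bigr => b /andP[hb /eqP hne].
  have b0 : (0 < INR b)%R by apply: lt_0_INR; lia.
  have : (INR b - INR a <> 0)%R by move=> e; apply: hne; apply: INR_eq; lra.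
  by move=> *; field; split; [lra|split; [lra|split; [lra|nra]]].
rewrite sum_inv_sub // sum_inv_add //.
have -> : harm a = (harm (a - 1) + / INR a)%R.
  by move: h; case: (a) => // c _; rewrite /harm subn1 [LHS]big_nat_recr.
by field; lra.
Qed.

Lemma harm_diff a N : (0 < a <= N)%N ->
  (0 <= harm (N + a) - harm (N - a) <= 2 * INR a * / INR (N.+1 - a))%R.
Proof.
move=> h.
have -> : (harm (N + a) - harm (N - a) = \rsum_((N - a).+1 <= j < (N + a).+1) / INR j)%R.
  by rewrite /harm (@big_cat_nat _ _ _ (N - a).+1 1 (N + a).+1) /=; [ring|lia|lia].
have p j : (0 < j)%N -> (0 < INR j)%R by move=> ?; apply: lt_0_INR; lia.
split.
  rewrite big_nat_cond; apply: big_ind; [lra|move=> *; lra|move=> j /andP[hj _]].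
  by apply: Rlt_le; apply: Rinv_0_lt_compat; apply: p; lia.
apply: Rle_trans (_ : \rsum_((N - a).+1 <= j < (N + a).+1) / INR (N.+1 - a) <= _)%R.
  apply: rsum_le => j hj; apply: Rinv_le_contravar; first by apply: p; lia.
  by apply: le_INR; lia.
rewrite rsum_const.
rewrite (_ : (N + a).+1 - (N - a).+1 = 2 * a)%N; last by lia.
rewrite -[(2 * a)%N]/(Nat.mul 2 a) mult_INR /=; lra.
Qed.

(* Telescoping [1/(b^2-a^2)] evaluates the off-diagonal part up to an error O(1/N). *)
Lemma zN_quad n N : (2 <= n)%N ->
  ((\rsum_(1 <= j < n) zN (2 * j) N * zN (2 * (n - j)) N) =
   (INR n + / 2) * zN (2 * n) N -
   \rsum_(1 <= a < N.+1) (/ INR a) ^ (2 * n - 1) * (harm (N + a) - harm (N - a)))%R.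
Proof.
move=> hn; pose w a := ((/ INR a) ^ 2)%R.
pose G a b := (\rsum_(1 <= j < n) w a ^ j * w b ^ (n - j))%R.
pose g a b := (w a ^ (n - 1) * / (INR b ^ 2 - INR a ^ 2))%R.
have w2 k a : ((/ INR a) ^ (2 * k) = w a ^ k)%R.
  by rewrite -[(2 * k)%N]/(Nat.mul 2 k) pow_mult.
transitivity (\rsum_(1 <= a < N.+1) \rsum_(1 <= b < N.+1) G a b)%R.
  rewrite /G; under [RHS]eq_bigr => a _ do rewrite exchange_big /=.
  rewrite [RHS]exchange_big /=; apply: eq_bigr => j _.
  rewrite /zN big_distrlr /=; apply: eq_bigr => a _; apply: eq_bigr => b _.
  by rewrite !w2.
(* Summing the finite geometric progression leaves two terms exchanged by [a] and [b], so the
   off-diagonal part is twice a single sum over [g]. *)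
have hG a b : (0 < a)%N -> (0 < b)%N -> b != a -> (G a b = g a b + g b a)%R.
  move=> ha hb /eqP hne.
  have a0 : (0 < INR a)%R by apply: lt_0_INR; lia.
  have b0 : (0 < INR b)%R by apply: lt_0_INR; lia.
  have d : (INR b - INR a <> 0)%R by move=> e; apply: hne; apply: INR_eq; lra.
  have d2 : (INR b ^ 2 - INR a ^ 2 <> 0)%R.
    rewrite (_ : INR b ^ 2 - INR a ^ 2 = (INR b - INR a) * (INR b + INR a))%R; last by ring.
    by apply: Rmult_integral_contrapositive; split => //; lra.
  have e := geom_conv (w a) (w b) (n - 1).
  rewrite (_ : (n - 1).+1 = n) in e; last by lia.
  rewrite -/(G a b) in e.
  have hw : (w a - w b = (INR b ^ 2 - INR a ^ 2) * (w a * w b))%R.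
    by rewrite /w; field; lra.
  have wa : (w a <> 0)%R by apply: pow_nonzero; apply: Rinv_neq_0_compat; lra.
  have wb : (w b <> 0)%R by apply: pow_nonzero; apply: Rinv_neq_0_compat; lra.
  have En x : (x ^ n = x * x ^ (n - 1))%R by rewrite tech_pow_Rmult; congr pow; lia.
  rewrite !En hw in e.
  apply: (Rmult_eq_reg_l ((INR b ^ 2 - INR a ^ 2) * (w a * w b))%R); last first.
    by do 2!(apply: Rmult_integral_contrapositive; split => //).
  rewrite e /g; field; split => //; lra.
have -> : (\rsum_(1 <= a < N.+1) \rsum_(1 <= b < N.+1) G a b =
   \rsum_(1 <= a < N.+1) G a a +
   2 * \rsum_(1 <= a < N.+1) \big[Rplus/0%R]_(1 <= b < N.+1 | b != a) g a b)%R.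
  transitivity (\rsum_(1 <= a < N.+1) (G a a + \big[Rplus/0%R]_(1 <= b < N.+1 | b != a) (g a b + g b a)))%R.
    apply: eq_big_nat => a ha; rewrite (bigD1_seq a) ?iota_uniq ?mem_index_iota //=.
    congr (_ + _)%R; rewrite big_nat_cond [RHS]big_nat_cond.
    by apply: eq_bigr => b /andP[hb hne]; apply: hG => //; lia.
  rewrite big_split /=; congr (_ + _)%R.
  under eq_bigr => a _ do rewrite big_split /=.
  rewrite big_split /= (_ : forall x : R, 2 * x = x + x)%R; last by move=> ?; ring.
  congr (_ + _)%R; rewrite (exchange_big_dep_nat predT) //=; apply: eq_bigr => a _.
  by apply: eq_bigl => b; rewrite eq_sym.
have Gd a : (0 < a)%N -> (G a a = (INR n - 1) * w a ^ n)%R.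
  move=> ha; rewrite /G.
  rewrite (eq_big_nat _ _ (F2 := fun _ => (w a ^ n)%R)) => [|j hj]; last first.
    by rewrite -pow_add; congr pow; rewrite -[Nat.add _ _]/(j + (n - j))%N; lia.
  by rewrite rsum_const minus_INR //; apply/leP; lia.
have -> : (\rsum_(1 <= a < N.+1) G a a = (INR n - 1) * zN (2 * n) N)%R.
  rewrite /zN big_distrr /=; apply: eq_big_nat => a ha; rewrite w2 Gd //; lia.
(* Twice the [3 / 4] of [sum_inv_sqr_sub] joins the diagonal [n - 1] to give the factor
   [n + 1 / 2]. *)
have -> : (2 * (\rsum_(1 <= a < N.+1) \big[Rplus/0%R]_(1 <= b < N.+1 | b != a) g a b) =
   3 / 2 * zN (2 * n) N + - \rsum_(1 <= a < N.+1)
     (/ INR a) ^ (2 * n - 1) * (harm (N + a) - harm (N - a)))%R.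
  rewrite -(rsum_opp _ _ _ predT) /zN !big_distrr -big_split /=; apply: eq_big_nat => a ha.
  rewrite /g -big_distrr /= sum_inv_sqr_sub; last by lia.
  rewrite w2 (_ : (/ INR a) ^ (2 * n - 1) = w a ^ (n - 1) * / INR a)%R; last first.
    rewrite -w2 Rmult_comm tech_pow_Rmult; congr pow; lia.
  rewrite (_ : w a ^ n = w a ^ (n - 1) * (/ INR a) ^ 2)%R; last first.
    by rewrite -/(w a) Rmult_comm tech_pow_Rmult; congr pow; lia.
  by field; have : (0 < INR a)%R by [apply: lt_0_INR; lia]; lra.
by field.
Qed.

Lemma zN_quad_error n : (2 <= n)%N -> is_lim_seq (fun N =>
  \rsum_(1 <= a < N.+1) (/ INR a) ^ (2 * n - 1) * (harm (N + a) - harm (N - a)))%R 0%R.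
Proof.
move=> hn; apply: (is_lim_seq_le_le (fun _ => 0%R) _
  (fun N => 2 * (zN 2 N * / INR N.+1 + 2 * / INR N.+1))%R).
- move=> N; split.
    rewrite big_nat_cond; apply: big_ind; [lra|move=> *; lra|move=> a /andP[ha _]].
    apply: Rmult_le_pos; last by case: (@harm_diff a N); [lia|].
    by apply: pow_le; case: a ha => // a _; case: (inv_INR_bounds a); lra.
  have N0 : (0 < INR N.+1)%R by apply: lt_0_INR; lia.
  apply: Rle_trans (_ : 2 * (zN 2 N * / INR N.+1 +
      \rsum_(1 <= a < N.+1) 2 * / (INR N.+1 * INR N.+1)) <= _)%R.
    rewrite /zN big_distrl -big_split big_distrr /=; apply: rsum_le => a ha.
    have [h0 h1] : (0 <= harm (N + a) - harm (N - a) <= 2 * INR a * / INR (N.+1 - a))%R.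
      by apply: harm_diff; lia.
    have [c0 c1] : (0 < / INR a <= 1)%R by case: a ha {h0 h1} => // a _; apply: inv_INR_bounds.
    have hp : ((/ INR a) ^ (2 * n - 1) <= (/ INR a) ^ 3)%R.
      rewrite (_ : (2 * n - 1)%N = Nat.add 3 (2 * n - 4)); last by lia.
      rewrite pow_add -[X in (_ <= X)%R]Rmult_1_r; apply: Rmult_le_compat_l.
        by apply: pow_le; lra.
      by rewrite -(pow1 (2 * n - 4)); apply: pow_incr; lra.
    apply: Rle_trans (_ : (/ INR a) ^ 3 * (2 * INR a * / INR (N.+1 - a)) <= _)%R.
      by apply: Rmult_le_compat => //; apply: pow_le; lra.
    have e : INR N.+1 = (INR a + INR (N.+1 - a))%R by rewrite -plus_INR; congr INR; lia.
    have y1 : (1 <= INR (N.+1 - a))%R by rewrite -[1%R]/(INR 1); apply: le_INR; lia.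
    have x1 : (1 <= INR a)%R by rewrite -[1%R]/(INR 1); apply: le_INR; lia.
    rewrite -/(INR N.+1) e; move: (INR a) (INR (N.+1 - a)) x1 y1 => x y x1 y1.
    (* Here [x + y = N + 1], so partial fractions extract [1 / (N + 1)]. For [x, y >= 1] one has
       [x y >= (x + y) / 2], which gives a second such factor in the mixed term. *)
    have -> : ((/ x) ^ 3 * (2 * x * / y) =
        2 * ((/ x) ^ 2 * / (x + y) + / (x * y) * / (x + y)))%R by field; lra.
    apply: Rmult_le_compat_l; first by lra.
    apply: Rplus_le_compat_l.
    have -> : (2 * / ((x + y) * (x + y)) = / ((x + y) / 2) * / (x + y))%R by field; lra.
    apply: Rmult_le_compat_r; first by apply: Rlt_le; apply: Rinv_0_lt_compat; lra.
    by apply: Rinv_le_contravar; nra.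
  rewrite rsum_const subn1 /=; apply: Rmult_le_compat_l; first by lra.
  apply: Rplus_le_compat_l.
  rewrite -/(INR N.+1).
  rewrite (_ : INR N * (2 * / (INR N.+1 * INR N.+1)) = INR N * / INR N.+1 * (2 * / INR N.+1))%R;
    last by field; lra.
  rewrite -[X in (_ <= X)%R]Rmult_1_l; apply: Rmult_le_compat_r.
    by apply: Rmult_le_pos; [lra|apply: Rlt_le; apply: Rinv_0_lt_compat].
  apply/Rle_div_l => //; rewrite S_INR; lra.
- exact: is_lim_seq_const.
- have h0 : is_lim_seq (fun N => / INR N.+1)%R 0%R.
    by have := is_lim_seq_inv _ _ (proj1 (is_lim_seq_incr_1 _ _) is_lim_seq_INR); apply.
  have h1 := is_lim_seq_mult' _ _ _ _ is_lim_zN2 h0.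
  have h2 := is_lim_seq_mult' _ _ _ _ (is_lim_seq_const 2%R) h0.
  have := is_lim_seq_mult' _ _ _ _ (is_lim_seq_const 2%R) (is_lim_seq_plus' _ _ _ _ h1 h2).
  by rewrite !Rmult_0_r Rplus_0_r Rmult_0_r.
Qed.

Lemma zeta_quad n : (2 <= n)%N ->
  (\rsum_(1 <= j < n) zeta (2 * j) * zeta (2 * (n - j)) = (INR n + / 2) * zeta (2 * n))%R.
Proof.
move=> hn.
have h1 : is_lim_seq (fun N => \rsum_(1 <= j < n) zN (2 * j) N * zN (2 * (n - j)) N)%R
    (\rsum_(1 <= j < n) zeta (2 * j) * zeta (2 * (n - j)))%R.
  rewrite /index_iota; have : all (fun j => (0 < j < n)%N) (iota 1 (n - 1)).
    by apply/allP => j; rewrite mem_iota; lia.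
  elim: (iota _ _) => [|j t IH] /=.
    move=> _; apply: (is_lim_seq_ext (fun _ => 0%R)) => [N|]; first by rewrite big_nil.
    by rewrite big_nil; exact: is_lim_seq_const.
  case/andP=> hj /IH{}IH; rewrite big_cons.
  apply: (is_lim_seq_ext (fun N => zN (2 * j) N * zN (2 * (n - j)) N +
    \big[Rplus/0%R]_(i <- t) (zN (2 * i) N * zN (2 * (n - i)) N))%R) => [N|].
    by rewrite big_cons.
  apply: is_lim_seq_plus' IH; apply: is_lim_seq_mult'; apply: is_lim_zN; lia.
have h2 : is_lim_seq (fun N => \rsum_(1 <= j < n) zN (2 * j) N * zN (2 * (n - j)) N)%R
    ((INR n + / 2) * zeta (2 * n) - 0)%R.
  apply: (is_lim_seq_ext _ _ _ (fun N => esym (zN_quad N hn))).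
  apply: is_lim_seq_minus' (zN_quad_error hn).
  apply: is_lim_seq_mult'; [exact: is_lim_seq_const|apply: is_lim_zN; lia].
have := is_lim_seq_unique _ _ h1; rewrite (is_lim_seq_unique _ _ h2); case=> <-; ring.
Qed.

(** * Bernoulli numbers *)

(** Sequences stand for formal power series: [conv] is their product, [shift] is multiplication by
    [X], and multiplying the coefficient [j] by [INR j] is the derivation [X d/dX], for which
    [conv_deriv] is the Leibniz rule. *)
Definition conv (a b : nat -> R) (k : nat) : R := \rsum_(0 <= j < k.+1) a j * b (k - j)%N.
Definition shift (a : nat -> R) (k : nat) : R := if k is j.+1 then a j else 0%R.

Lemma convA a b c k : conv (conv a b) c k = conv a (conv b c) k.
Proof.
rewrite /conv.
transitivity (\rsum_(0 <= i < k.+1) \big[Rplus/0%R]_(0 <= j < k.+1 | (j <= i)%N)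
    (a j * b (i - j)%N * c (k - i)%N)%R).
  apply: eq_big_nat => i hi; rewrite big_distrl /=.
  by rewrite (@big_nat_widen _ _ _ 0 i.+1 k.+1).
rewrite (exchange_big_dep_nat predT) //=; apply: eq_big_nat => j hj.
transitivity (\rsum_(j <= i < k.+1) a j * b (i - j)%N * c (k - i)%N)%R.
  by rewrite [RHS](@big_nat_widenl _ _ _ j 0 k.+1).
rewrite -{1}[j]add0n big_addn subSn; last by lia.
rewrite big_distrr /=; apply: eq_big_nat => i hi.
by rewrite addnK -Rmult_assoc; congr (_ * _ * c _)%R; lia.
Qed.

Lemma conv_ext a b b' k : (forall j, (j <= k)%N -> b j = b' j) -> conv a b k = conv a b' k.
Proof. by move=> E; apply: eq_big_nat => j hj; rewrite E //; lia. Qed.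

Lemma convC a b k : conv a b k = conv b a k.
Proof.
rewrite /conv [LHS]big_nat_rev /=; apply: eq_big_nat => j hj.
by rewrite Rmult_comm; congr (b _ * a _)%R; lia.
Qed.

Lemma conv_shift a b k : conv a (shift b) k = shift (conv a b) k.
Proof.
rewrite /conv; case: k => [|k]; first by rewrite big_nat1 /= Rmult_0_r.
rewrite big_nat_recr //= subnn /= Rmult_0_r Rplus_0_r; apply: eq_big_nat => j hj.
by rewrite subSn //; lia.
Qed.

Lemma conv_deriv a b k :
  (INR k * conv a b k = conv (fun j => INR j * a j) b k + conv a (fun j => INR j * b j) k)%R.
Proof.
rewrite /conv -big_split big_distrr /=; apply: eq_big_nat => j hj.
by rewrite minus_INR; [ring|lia].
Qed.

(* [B(X)] with [X B' = B - B^2 - X B] and [B(0) = 1] is [X / (e^X - 1)]: with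
   [S = B (e^X - 1) / X] one gets [X S' = B (1 - S)]. *)
Lemma bernoulli_of_riccati (b : nat -> R) : b 0%N = 1%R ->
  (forall k, INR k * b k = b k - conv b b k - shift b k)%R ->
  forall k, conv b (fun j => / INR (fact j.+1))%R k = if k is 0%N then 1%R else 0%R.
Proof.
move=> b0 hb; pose e j := (/ INR (fact j.+1))%R.
have fS j : INR (fact j.+1) = (INR j.+1 * INR (fact j))%R by rewrite -mult_INR.
(* [e] is the series [E = (e^X - 1) / X], which satisfies [X E' = 1 + X E - E]. *)
have he j : (INR j * e j = (if j is 0%N then 1 else 0) + shift e j - e j)%R.
  rewrite /e; case: j => [|j]; first by rewrite /=; field.
  rewrite fS /shift (S_INR j.+1).
  have := INR_fact_neq_0 j.+1; have := pos_INR j.+1 => *; field; lra.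
suff H : forall k j, (j <= k)%N -> conv b e j = if j is 0%N then 1%R else 0%R.
  by move=> k; apply: (H k).
elim=> [|k IH] j hj.
  have -> : j = 0%N by lia.
  by rewrite /conv big_nat1 b0 /e /=; field.
case: (ltnP j k.+1) => hj'; first by apply: IH; lia.
have {hj hj'}-> : j = k.+1 by lia.
have S0 : conv b e 0 = 1%R by apply: (IH 0%N).
have H1 : conv (fun j => INR j * b j)%R e k.+1
    = (conv b e k.+1 - conv b (conv b e) k.+1 - conv b e k)%R.
  rewrite -convA -[conv b e k]/(shift (conv b e) k.+1) -conv_shift.
  rewrite (convC b (shift e)) -/(conv _ _ _).
  have -> : conv (shift e) b k.+1 = conv (shift b) e k.+1.
    by rewrite convC conv_shift [RHS]convC conv_shift /= convC.
  rewrite /Rminus {1 3 5}/conv -/(conv b b) -!(rsum_opp _ _ _ predT) -!big_split /=.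
  apply: eq_bigr => i _; rewrite hb; ring.
have H2 : conv b (fun j => INR j * e j)%R k.+1 = (b k.+1 + conv b e k - conv b e k.+1)%R.
  rewrite (conv_ext b (fun j _ => he j)).
  rewrite -[conv b e k]/(shift (conv b e) k.+1) -conv_shift.
  have -> : b k.+1 = conv b (fun j => if j is 0%N then 1 else 0)%R k.+1.
    rewrite /conv big_nat_recr //= subnn Rmult_1_r big_nat_cond big1 ?Rplus_0_l // => i /andP[hi _].
    by rewrite (_ : k.+1 - i = (k - i).+1)%N; [ring|lia].
  rewrite /Rminus {2 3 4}/conv -!(rsum_opp _ _ _ predT) -!big_split /=.
  by apply: eq_bigr => i _; ring.
(* By induction the intermediate coefficients of [S = B E] vanish, so only the two end terms of the
   product [B S] survive. *)
have H3 : conv b (conv b e) k.+1 = (conv b e k.+1 + b k.+1)%R.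
  rewrite {1}/conv big_ltn // big_nat_recr //= subnn S0 b0 subn0.
  rewrite big_nat_cond big1 => [|i /andP[hi _]]; first by ring.
  rewrite (IH (k.+1 - i)%N); last by lia.
  by rewrite (_ : k.+1 - i = (k - i).+1)%N; [ring|lia].
(* All else cancels and [(k + 1) S = - S] remains for the coefficient [S] of degree [k + 1], so it
   is zero. *)
have := conv_deriv b e k.+1; rewrite H1 H2 H3.
have : (0 < INR k.+1)%R by apply: lt_0_INR; lia.
nra.
Qed.

(* [B_p / p!] *)
Definition bern (p : nat) : R :=
  match p with
  | 0 => 1
  | 1 => - / 2
  | _ => if odd p then 0 else -2 * (-1) ^ p./2 * zeta p / (2 * PI) ^ p
  end%R.

Lemma bern0 : bern 0 = 1%R. Proof. by []. Qed.
Lemma bern1 : bern 1 = (- / 2)%R. Proof. by []. Qed.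

Lemma bernE p : (1 < p)%N ->
  bern p = (if odd p then 0 else -2 * (-1) ^ p./2 * zeta p / (2 * PI) ^ p)%R.
Proof. by case: p => [|[|p]]. Qed.

Lemma bern_odd p : odd p -> (1 < p)%N -> bern p = 0%R.
Proof. by move=> ho hp; rewrite bernE // ho. Qed.

Lemma bern_even i : (0 < i)%N ->
  bern (2 * i) = (-2 * (-1) ^ i * zeta (2 * i) / (2 * PI) ^ (2 * i))%R.
Proof. by move=> hi; rewrite bernE ?mul2n ?odd_double ?doubleK //; lia. Qed.

Lemma rsum_even (G : nat -> R) m : (forall j, odd j -> (1 < j)%N -> G j = 0%R) ->
  \rsum_(2 <= j < (2 * m).+1) G j = \rsum_(1 <= i < m.+1) G (2 * i)%N.
Proof.
move=> HG; elim: m => [|m IH]; first by rewrite !big_geq.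
rewrite [RHS]big_nat_recr //= -IH (_ : (2 * m.+1).+1 = (2 * m).+3); last by lia.
case: m {IH} => [|m]; first by rewrite big_nat1 big_geq // Rplus_0_l.
rewrite big_nat_recr; last by lia.
rewrite big_nat_recr; last by lia.
rewrite (HG (2 * m.+1).+1); [|by rewrite oddS mul2n odd_double|lia].
by rewrite /= Rplus_0_r; congr (_ + G _)%R; lia.
Qed.

(** Degree 2 is the value of [zeta 2]. From degree 3 on, the terms with [bern 1] cancel
    [shift bern], and the middle of the square must equal [-(k + 1) bern k]: for odd [k] each
    product has an odd index above 1, for even [k] this is [zeta_quad]. *)
Lemma bern_quad k : (INR k * bern k = bern k - conv bern bern k - shift bern k)%R.
Proof.
case: k => [|[|[|k]]].
- by rewrite /conv big_nat1 /=; ring.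
- by rewrite /conv big_nat_recr // big_nat1 /=; field.
- rewrite /conv !big_nat_recr // big_geq //=.
  by rewrite zeta2; have := PI_RGT_0 => ?; field; lra.
have -> : shift bern k.+3 = bern (k.+3 - 1) by rewrite subn1.
move: k.+3 (isT : 2 < k.+3)%N => m hm.
have split3 (G : nat -> R) :
    (\rsum_(2 <= i < m.+1) G i = \rsum_(2 <= i < m - 1) G i + G (m - 1)%N + G m)%R.
  case: m hm => // m hm; rewrite big_nat_recr /=; last by lia.
  by case: m hm => // m hm; rewrite big_nat_recr /= ?subn1 //; lia.
rewrite /conv big_ltn // big_ltn; last by lia.
rewrite split3 subnn subn0 (_ : (m - (m - 1) = 1)%N); last by lia.
suff : (\rsum_(2 <= i < m - 1) bern i * bern (m - i) = - ((INR m + 1) * bern m))%R.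
  by move=> ->; rewrite bern0 bern1; field.
case hodd : (odd m).
  rewrite (bern_odd hodd (ltnW hm)) big_nat_cond big1 => [|i /andP[hi _]]; first by ring.
  case hi2 : (odd i); first by rewrite (bern_odd hi2); [ring|lia].
  by rewrite (@bern_odd (m - i)); [ring|rewrite oddB ?hodd ?hi2 //; lia|lia].
have [n en] : exists n, m = (2 * n)%N.
  by exists m./2; rewrite mul2n; move: (odd_double_half m); rewrite hodd; lia.
have hn : (1 < n)%N by lia.
rewrite en (_ : 2 * n - 1 = (2 * (n - 1)).+1)%N; last by lia.
rewrite (rsum_even (G := fun i => bern i * bern (2 * n - i))%R); last first.
  by move=> j hj1 hj2; rewrite (bern_odd hj1) // Rmult_0_l.
have pi0 : (2 * PI <> 0)%R by have := PI_RGT_0; lra.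
rewrite (_ : (n - 1).+1 = n); last by lia.
transitivity (\rsum_(1 <= i < n) (4 * (-1) ^ n / (2 * PI) ^ (2 * n)) *
    (zeta (2 * i) * zeta (2 * (n - i))))%R.
  apply: eq_big_nat => i hi.
  rewrite (_ : 2 * n - 2 * i = 2 * (n - i))%N; last by lia.
  rewrite !bern_even; try lia.
  have -> : ((-1) ^ n = (-1) ^ i * (-1) ^ (n - i))%R by rewrite -pow_add; congr pow; lia.
  have -> : ((2 * PI) ^ (2 * n) = (2 * PI) ^ (2 * i) * (2 * PI) ^ (2 * (n - i)))%R.
    by rewrite -pow_add; congr pow; lia.
  by field; split; exact: pow_nonzero.
rewrite -big_distrr /= zeta_quad // bern_even; last by lia.
have -> : INR (2 * n) = (2 * INR n)%R by rewrite -[(2 * n)%N]/(Nat.mul 2 n) mult_INR.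
field; exact: pow_nonzero.
Qed.

Lemma bern_conv k :
  conv bern (fun j => / INR (fact j.+1))%R k = if k is 0%N then 1%R else 0%R.
Proof. exact: bernoulli_of_riccati bern_quad k. Qed.

(** Induction on [n]: the increment of the right side is the product of [bern], [(e^X - 1) / X] and
    the series of divided powers of [n]. The first two are inverse to each other by [bern_conv],
    which leaves [dpow s (INR n)]. The sum contains [v = 0], which counts when [s = 0]. *)
Lemma faulhaber s n :
  \rsum_(0 <= v < n) dpow s (INR v) =
  (\rsum_(0 <= p < s.+1) bern p * dpow (s.+1 - p) (INR n))%R.
Proof.
elim: n => [|n IH].
  rewrite big_geq // big_nat_cond big1 // => p /andP[hp _].
  by rewrite (_ : s.+1 - p = (s - p).+1)%N /dpow /=; [rewrite /Rdiv; ring|lia].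
pose e j := (/ INR (fact j.+1))%R; pose d l := dpow l (INR n).
rewrite big_nat_recr // IH S_INR.
have step m : (dpow m.+1 (INR n + 1) = dpow m.+1 (INR n) + conv e d m)%R.
  rewrite convC /conv dpowD big_nat_recr //= subnn Rplus_comm; congr (_ + _)%R.
    by rewrite (_ : dpow 0 1 = 1)%R ?Rmult_1_r // /dpow /=; field.
  apply: eq_big_nat => l hl; rewrite /d /e subSn; last by lia.
  by rewrite /dpow pow1 /Rdiv Rmult_1_l.
transitivity (\rsum_(0 <= p < s.+1) bern p * dpow (s.+1 - p) (INR n) + conv bern (conv e d) s)%R.
  congr (_ + _)%R; rewrite -convA [RHS]big_nat_recl //= bern_conv subn0 big_nat_cond big1 => [|i _]; first by rewrite /d; ring.
  by rewrite bern_conv; ring.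
rewrite [X in (_ + X)%R]/conv -big_split; apply: eq_big_nat => p hp.
by rewrite subSn ?step /=; [ring|lia].
Qed.

(** * Convolution of two divided powers in closed form *)

Definition coefA (a c p : nat) : R :=
  ((-1) ^ c * INR 'C(p - 1, c) + (-1) ^ a * INR 'C(p - 1, a))%R.

Definition delta0 (a : nat) : R := if a is 0%N then 1%R else 0%R.

Definition convpow (a c n : nat) : R :=
  \rsum_(1 <= u < n) dpow a (INR u) * dpow c (INR (n - u)).

(** The Euler-Maclaurin form of [convpow]: the beta integral, minus half the values at the two ends
    of the open range, then the Bernoulli terms. *)
Definition convpow_closed (a c : nat) (x : R) : R :=
  (dpow (a + c).+1 x - / 2 * (delta0 c * dpow a x + delta0 a * dpow c x)
   + \rsum_(2 <= p < (a + c).+2) bern p * coefA a c p * dpow ((a + c).+1 - p) x)%R.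

Lemma dpow_mulx a x : (INR a.+1 * dpow a.+1 x = x * dpow a x)%R.
Proof.
rewrite /dpow -tech_pow_Rmult (_ : fact a.+1 = Nat.mul a.+1 (fact a)) // mult_INR.
by field; split; [apply: INR_fact_neq_0|apply: not_0_INR].
Qed.

Lemma convpow_rec a c n :
  (INR a.+1 * convpow a.+1 c n + INR c.+1 * convpow a c.+1 n = INR n * convpow a c n)%R.
Proof.
rewrite /convpow !big_distrr -big_split /=; apply: eq_big_nat => u hu.
rewrite -!/(INR _.+1) -Rmult_assoc dpow_mulx.
rewrite (_ : INR n = INR u + INR (n - u))%R; last by rewrite -plus_INR; congr INR; lia.
transitivity (INR u * dpow a (INR u) * dpow c (INR (n - u)) +
   dpow a (INR u) * (INR c.+1 * dpow c.+1 (INR (n - u))))%R; first by rewrite /=; ring.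
by rewrite dpow_mulx; ring.
Qed.

Lemma coefA_rec a c p : (0 < p <= (a + c).+2)%N ->
  (INR a.+1 * coefA a.+1 c p + INR c.+1 * coefA a c.+1 p
   = INR ((a + c).+2 - p) * coefA a c p)%R.
Proof.
move=> hp; rewrite /coefA minus_INR; last by lia.
have H m : (INR m.+1 * INR 'C(p - 1, m.+1) = (INR p - INR m.+1) * INR 'C(p - 1, m))%R.
  rewrite -mult_INR multE mul_bin_left -multE mult_INR.
  case: (leqP m (p - 1)) => hm; last by rewrite bin_small //=; ring.
  by congr (_ * _)%R; rewrite -minus_INR; [congr INR|]; lia.
have := H a; have := H c; rewrite -!tech_pow_Rmult.
move: (INR 'C(p - 1, a.+1)) (INR 'C(p - 1, c.+1)) => x y hy hx.
have -> : INR (a + c).+2 = (INR a.+1 + INR c.+1)%R by rewrite -plus_INR; congr INR; lia.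
transitivity (INR a.+1 * ((-1) ^ c * INR 'C(p - 1, c)) - (-1) ^ a * (INR a.+1 * x)
   + INR c.+1 * ((-1) ^ a * INR 'C(p - 1, a)) - (-1) ^ c * (INR c.+1 * y))%R; first by ring.
by rewrite hx hy; ring.
Qed.

Lemma convpow_closed_rec a c x :
  (INR a.+1 * convpow_closed a.+1 c x + INR c.+1 * convpow_closed a c.+1 x
   = x * convpow_closed a c x)%R.
Proof.
rewrite /convpow_closed addSn addnS.
set S1 := \rsum_(2 <= p < _) bern p * coefA a.+1 c p * _.
set S2 := \rsum_(2 <= p < _) bern p * coefA a c.+1 p * _.
set S3 := \rsum_(2 <= p < _) bern p * coefA a c p * _.
have E : (INR a.+1 * S1 + INR c.+1 * S2 = x * S3)%R.
  transitivity (\rsum_(2 <= p < (a + c).+3)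
      bern p * (INR ((a + c).+2 - p) * coefA a c p) * dpow ((a + c).+2 - p) x)%R.
    rewrite /S1 /S2 !big_distrr -big_split; apply: eq_big_nat => p hp.
    by rewrite -coefA_rec /=; [ring|lia].
  rewrite big_nat_recr // subnn [INR 0]/(0%R) Rmult_0_l Rmult_0_r Rmult_0_l Monoid.mulm1.
  rewrite /S3 big_distrr; apply: eq_big_nat => p hp.
  rewrite (_ : (a + c).+2 - p = ((a + c).+1 - p).+1)%N; last by lia.
  transitivity (bern p * coefA a c p * (INR ((a + c).+1 - p).+1 * dpow ((a + c).+1 - p).+1 x))%R.
    by ring.
  by rewrite dpow_mulx /=; ring.
transitivity ((INR a.+1 + INR c.+1) * dpow (a + c).+2 x
  - / 2 * (delta0 c * (INR a.+1 * dpow a.+1 x) + delta0 a * (INR c.+1 * dpow c.+1 x))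
  + (INR a.+1 * S1 + INR c.+1 * S2))%R; first by rewrite (_ : delta0 a.+1 = 0%R) // (_ : delta0 c.+1 = 0%R) //; ring.
have -> : (INR a.+1 + INR c.+1 = INR (a + c).+2)%R by rewrite -plus_INR; congr INR; lia.
by rewrite E !dpow_mulx; ring.
Qed.

Lemma convpowE a c n : (0 < n)%N -> convpow a c n = convpow_closed a c (INR n).
Proof.
move=> hn; elim: a c => [|a IH] c; last first.
  have a0 : (0 < INR a.+1)%R by apply: lt_0_INR; lia.
  apply: (Rmult_eq_reg_l (INR a.+1)); last by lra.
  by have := convpow_rec a c n; have := convpow_closed_rec a c (INR n); rewrite !IH; lra.
have -> : convpow 0 c n = (\rsum_(0 <= v < n) dpow c (INR v) - delta0 c)%R.
  rewrite big_ltn // /convpow big_nat_rev /=.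
  rewrite (_ : dpow c 0 = delta0 c); last first.
    by case: (c) => [|m]; rewrite /dpow /delta0 /= /Rdiv; [field|ring].
  rewrite (_ : forall y z : R, y + z - y = z)%R; last by move=> *; ring.
  apply: eq_big_nat => v hv; rewrite {1}/dpow /= Rdiv_1_r Rmult_1_l.
  by congr (dpow _ (INR _)); lia.
rewrite faulhaber /convpow_closed add0n big_ltn // subn0 bern0 (_ : delta0 0 = 1%R) //.
case: c => [|c].
  rewrite big_geq // big_geq // /dpow /=; field.
rewrite big_ltn // subn1 (_ : delta0 c.+1 = 0%R) // bern1.
rewrite [X in _ = (_ + X)%R]big_nat_recr; last by lia.
(* Faulhaber's polynomial has no constant term, so the last term of the closed form must vanish:
   [bern] does for odd [c], and [coefA] is [1 - 1] for even [c]. *)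
rewrite (_ : bern c.+2 * coefA 0 c.+1 c.+2 = 0)%R; last first.
  case ho : (odd c); first by rewrite bern_odd //= ?negbK ?ho //; ring.
  have e : ((-1) ^ c = 1)%R.
    rewrite -(odd_double_half c) ho add0n -mul2n -[(2 * c./2)%N]/(Nat.mul 2 c./2) pow_mult.
    by rewrite (_ : (-1) ^ 2 = 1)%R ?pow1 //; ring.
  rewrite /coefA subn1 binn bin0 -tech_pow_Rmult e /=; ring.
have -> : (\rsum_(2 <= p < c.+2) bern p * coefA 0 c.+1 p * dpow (c.+2 - p) (INR n) =
    \rsum_(2 <= p < c.+2) bern p * dpow (c.+2 - p) (INR n))%R.
  apply: eq_big_nat => p hp; rewrite /coefA bin_small; last by lia.
  by rewrite bin0 /=; ring.
by rewrite /=; ring.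
Qed.

Lemma bern_sign p : (1 < p)%N -> (bern p * (-1) ^ p = bern p)%R.
Proof.
move=> hp; case ho : (odd p); first by rewrite bern_odd //; ring.
rewrite -(odd_double_half p) ho add0n -mul2n -[X in ((-1) ^ X)%R]/(Nat.mul 2 p./2) pow_mult.
by rewrite (_ : (-1) ^ 2 = 1)%R ?pow1; ring.
Qed.

Lemma delta_delta0 a : delta a.+1 1 = RtoC (delta0 a).
Proof. by case: a. Qed.

Lemma rphi_conv r s N : (0 < r)%N -> (0 < s)%N -> (0 < N)%N ->
  (\rsum_(1 <= u < N) rphi r u * rphi s (N - u) =
   rphi (r + s) N + / 2 * (delta0 (s - 1) * rphi r N + delta0 (r - 1) * rphi s N)
   + \rsum_(2 <= p < r + s) bern p * coefA (r - 1) (s - 1) p * rphi (r + s - p) N)%R.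
Proof.
case: r s => // a [] // c _ _ hN; rewrite addSn addnS !subn1 !rphiS /=.
transitivity ((-1) ^ (a + c) * convpow a c N)%R.
  rewrite /convpow big_distrr /=; apply: eq_big_nat => u hu.
  by rewrite !rphiS /= -[(a + c)%N]/(Nat.add a c) pow_add; ring.
rewrite convpowE // /convpow_closed.
have -> : (\rsum_(2 <= p < (a + c).+2) bern p * coefA a c p * rphi ((a + c).+2 - p) N =
  (-1) ^ (a + c) * \rsum_(2 <= p < (a + c).+2) bern p * coefA a c p * dpow ((a + c).+1 - p) (INR N))%R.
  rewrite big_distrr /=; apply: eq_big_nat => p hp.
  rewrite (_ : (a + c).+2 - p = ((a + c).+1 - p).+1)%N ?rphiS; last by lia.
  have hp1 : (1 < p)%N by case/andP: hp.
  rewrite -{1}(bern_sign hp1).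
  have -> : ((-1) ^ (a + c) = (-1) ^ p * (-1) ^ ((a + c).+1 - p).+1)%R.
    rewrite -pow_add (_ : Nat.add p _ = (a + c).+2); last by lia.
    by rewrite -!tech_pow_Rmult; ring.
  by ring.
have h0 : (delta0 c * (-1) ^ c = delta0 c)%R by case: (c) => [|m] /=; ring.
have h1 : (delta0 a * (-1) ^ a = delta0 a)%R by case: (a) => [|m] /=; ring.
rewrite -[(a + c)%N]/(Nat.add a c) !pow_add.
by rewrite -[in RHS]h0 -[in RHS]h1; ring.
Qed.

(** The coefficient of [x^N] on the left is the convolution [rphi_conv]. At [x = q^m] this evaluates
    the diagonal of the harmonic product. *)
Lemma Phi_sqr r s x : (0 < r)%N -> (0 < s)%N -> (Cmod x < 1)%R ->
  Phi r x * Phi s x =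
  Phi (r + s) x
  + RtoC (/ 2) * (RtoC (delta0 (s - 1)) * Phi r x + RtoC (delta0 (r - 1)) * Phi s x)
  + \csum_(2 <= p < r + s) RtoC (bern p * coefA (r - 1) (s - 1) p) * Phi (r + s - p) x.
Proof.
move=> hr hs hx.
have h n := psum_aphi n hx.
apply: (psum_unique (psum_cauchy (pabs_aphi r hx) (pabs_aphi s hx) (h r) (h s))).
have H1 := psum_scal (RtoC (/ 2)) (psum_plus (psum_scal (RtoC (delta0 (s - 1))) (h r))
   (psum_scal (RtoC (delta0 (r - 1))) (h s))).
have H2 : psum (fun n => \csum_(2 <= p < r + s)
      RtoC (bern p * coefA (r - 1) (s - 1) p) * aphi (r + s - p) x n)
    (\csum_(2 <= p < r + s) RtoC (bern p * coefA (r - 1) (s - 1) p) * Phi (r + s - p) x).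
  by apply: psum_csum => p _; apply: psum_scal.
apply: psum_ext (psum_plus (psum_plus (h (r + s)%N) H1) H2) => N hN.
transitivity (RtoC (\rsum_(1 <= u < N) rphi r u * rphi s (N - u)) * Cpow x N).
  rewrite rphi_conv // /aphi; move: rphi => f.
  rewrite !RtoC_plus !RtoC_mult !RtoC_plus csum_RtoC !RtoC_mult.
  rewrite !Cmult_plus_distr_r big_distrl /=; congr (_ + _ + _); first by ring.
  by apply: eq_bigr => p _; rewrite !RtoC_mult; ring.
rewrite csum_RtoC big_distrl; apply: eq_big_nat => u hu /=.
rewrite /aphi; move: rphi => f; rewrite RtoC_mult (_ : Cpow x N = Cpow x u * Cpow x (N - u)); first by ring.
by rewrite -Cpow_add_r; congr Cpow; lia.
Qed.

(** For odd [p] both sides are zero, so odd zeta values never need evaluating. For even [p] this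
    only unfolds [bern] and [(2 pi i)^p]; Euler's theorem lies in [bern_conv]. *)
Lemma zetat_bern p : (1 < p)%N -> (RtoC 1 + sgnC p) * zetat p = - RtoC (bern p).
Proof.
move=> hp; rewrite /zetat (_ : Nat.eqb p 1 = false); last by apply/Nat.eqb_neq; lia.
rewrite /sgnC -RtoC_pow.
case ho : (odd p).
  rewrite bern_odd // (_ : (-1) ^ p = -1)%R.
    rewrite -RtoC_plus (_ : 1 + -1 = 0)%R; last by ring.
    by rewrite Cmult_0_l; ring.
  rewrite -(odd_double_half p) ho -mul2n -[X in ((-1) ^ X)%R]/(Nat.add 1 (Nat.mul 2 p./2)).
  by rewrite pow_add pow_mult (_ : (-1) ^ 2 = 1)%R ?pow1; ring.
have [i hi] : exists i, p = (2 * i)%N.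
  by exists p./2; rewrite mul2n; move: (odd_double_half p); rewrite ho; lia.
rewrite hi bern_even; last by lia.
have P0 : (2 * PI <> 0)%R by have := PI_RGT_0; lra.
have -> : Cpow twopii (2 * i) = RtoC ((-1) ^ i * (2 * PI) ^ (2 * i)).
  rewrite /twopii Cpow_mult_l [in RHS]RtoC_mult !RtoC_pow Cmult_comm; congr (_ * _).
  rewrite -[(2 * i)%N]/(Nat.mul 2 i) Cpow_mult_r; congr Cpow.
  by rewrite /= /Ci; apply: injective_projections => /=; ring.
have e : ((-1) ^ (2 * i) = 1)%R.
  by rewrite -[(2 * i)%N]/(Nat.mul 2 i) pow_mult (_ : (-1) ^ 2 = 1)%R ?pow1 //; ring.
have e2 : ((-1) ^ i * (-1) ^ i = 1)%R by rewrite -pow_add -e; congr pow; lia.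
have n1 : ((-1) ^ i <> 0)%R by apply: pow_nonzero; lra.
have n2 : ((2 * PI) ^ (2 * i) <> 0)%R by exact: pow_nonzero.
rewrite e -RtoC_div; last by apply: Rmult_integral_contrapositive.
rewrite -RtoC_plus -RtoC_mult -RtoC_opp; congr RtoC.
transitivity (2 * ((-1) ^ i * (-1) ^ i) * zeta (2 * i) / ((-1) ^ i * (2 * PI) ^ (2 * i)))%R.
  by rewrite e2; field.
by field.
Qed.

(** * Binomial identities *)

Lemma sum_pairsE k (a : nat -> nat -> C) : (0 < k)%N ->
  sum_pairs k a = \csum_(1 <= i < k) a i (k - i)%N.
Proof. by case: k => // k _; rewrite /sum_pairs sum_n_m_csum minusE subn1. Qed.

Lemma deltaE a b : delta a b = if a == b then RtoC 1 else RtoC 0.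
Proof. by rewrite /delta; case: Nat.eqb_spec; case: eqP. Qed.

Lemma csum_delta (F : nat -> C) k a : (0 < a < k)%N ->
  \csum_(1 <= i < k) (delta i a * F i) = F a.
Proof.
move=> h; rewrite (bigD1_seq a) ?iota_uniq ?mem_index_iota //=.
rewrite deltaE eqxx big1 => [|i /negPf hi]; first by rewrite Cmult_1_l Cplus_0_r.
by rewrite deltaE hi Cmult_0_l.
Qed.

(* Repeated use of this identity is the [P]-th finite difference of [F]. *)
Lemma binomial_difference (F : nat -> R) P :
  (\rsum_(0 <= j < P.+2) (-1) ^ j * INR 'C(P.+1, j) * F j =
   \rsum_(0 <= j < P.+1) (-1) ^ j * INR 'C(P, j) * (F j - F j.+1))%R.
Proof.
have E : (\rsum_(0 <= j < P.+1) (-1) ^ j * INR 'C(P, j) * F j =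
    F 0%N + \rsum_(0 <= j < P.+1) (-1) ^ j.+1 * INR 'C(P, j.+1) * F j.+1)%R.
  transitivity (\rsum_(0 <= j < P.+2) (-1) ^ j * INR 'C(P, j) * F j)%R.
    by rewrite [RHS]big_nat_recr //= (bin_small (ltnSn P)) /= Rmult_0_r Rmult_0_l Rplus_0_r.
  by rewrite big_nat_recl // bin0 /= !Rmult_1_l.
transitivity (\rsum_(0 <= j < P.+1) (-1) ^ j * INR 'C(P, j) * F j +
    \rsum_(0 <= j < P.+1) (-1) ^ j.+1 * INR 'C(P, j) * F j.+1)%R.
  rewrite E big_nat_recl // bin0 pow_O [INR 1]/(1%R) !Rmult_1_l Rplus_assoc; congr (_ + _)%R.
  rewrite -big_split; apply: eq_bigr => j _.
  by rewrite binS -[('C(_, _) + _)%N]/(Nat.add _ _) plus_INR /=; ring.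
by rewrite -big_split; apply: eq_bigr => j _ /=; ring.
Qed.

(** By Pascal's rule each difference lowers [S] by one, up to sign; a constant is reached too early
    unless [P <= S], and the value at [0] vanishes if [P < S]. *)
Lemma binomial_orthogonality P S :
  (\rsum_(0 <= j < P.+1) (-1) ^ j * INR 'C(P, j) * INR 'C(j, S) =
   if P == S then (-1) ^ S else 0)%R.
Proof.
elim: P S => [|P IH] S.
  by rewrite big_nat1 bin0 /=; case: S => [|S]; rewrite ?bin0 ?bin0n /=; ring.
rewrite (binomial_difference (fun j => INR 'C(j, S))); case: S => [|S].
  by rewrite big1 // => j _; rewrite !bin0; ring.
transitivity (- \rsum_(0 <= j < P.+1) (-1) ^ j * INR 'C(P, j) * INR 'C(j, S))%R.
  rewrite -(rsum_opp _ _ _ predT); apply: eq_bigr => j _.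
  by rewrite (binS j S) -[('C(_, _) + _)%N]/(Nat.add _ _) plus_INR; ring.
by rewrite IH eqSS; case: eqP => _ /=; ring.
Qed.

(** The reflected version: the induction trades [P + 1] at [n + 1] for [P] at [n + 1] and at [n],
    and Pascal's rule closes it. The bound keeps the outer subtractions from being truncated. *)
Lemma binomial_alternating P n S : (P <= n + S)%N ->
  (\rsum_(0 <= j < P.+1) (-1) ^ j * INR 'C(P, j) * INR 'C(n + S - j, S) =
   INR 'C(n + S - P, n))%R.
Proof.
elim: P n => [|P IH] n hP.
  rewrite big_nat1 bin0 !subn0 -(bin_sub (leq_addr S n)) addKn /=; ring.
case: n hP => [|n] hP.
  rewrite big_nat_recl // bin0 big1 => [|j _].
    by rewrite add0n subn0 binn bin0 /=; ring.
  by rewrite (@bin_small (0 + S - j.+1)) /=; [ring|lia].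
rewrite (binomial_difference (fun j => INR 'C(n.+1 + S - j, S))).
transitivity (\rsum_(0 <= j < P.+1) (-1) ^ j * INR 'C(P, j) * INR 'C(n.+1 + S - j, S) -
   \rsum_(0 <= j < P.+1) (-1) ^ j * INR 'C(P, j) * INR 'C(n + S - j, S))%R.
  rewrite /Rminus -(rsum_opp _ _ _ predT) -big_split; apply: eq_bigr => j _.
  by rewrite (_ : n.+1 + S - j.+1 = n + S - j)%N /=; [ring|lia].
rewrite !IH; try lia.
rewrite (_ : n.+1 + S - P = (n.+1 + S - P.+1).+1)%N; last by lia.
rewrite (_ : n + S - P = n.+1 + S - P.+1)%N; last by lia.
by rewrite binS -[('C(_, _) + _)%N]/(Nat.add _ _) plus_INR; ring.
Qed.

(** This is the total coefficient of [zetat p * fo (r + s - p)] on the shuffle side: the first term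
    comes from [Zoe], the sum from [Zoo]. The first half of the sum cancels that term ([B]), the
    second half yields the Kronecker delta ([A]). *)
Lemma zeta_coefficient r s p : (0 < r)%N -> (0 < s)%N -> (0 < p < r + s)%N ->
  (INR 'C(r + s - p - 1, r - 1) + \rsum_(1 <= i < r + s) INR 'C(i - 1, s - 1) *
     ((-1) ^ (r + s - i) * INR 'C(p - 1, r + s - i - 1) + (-1) ^ (p + i) * INR 'C(p - 1, i - 1))
   = if p == s then 1 else 0)%R.
Proof.
case: r s p => // n [] // S [] // P _ _; rewrite addSn addnS => hP.
have trunc (F : nat -> R) : (\rsum_(0 <= j < (n + S).+1) (-1) ^ j * INR 'C(P, j) * F j =
    \rsum_(0 <= j < P.+1) (-1) ^ j * INR 'C(P, j) * F j)%R.
  rewrite (@big_cat_nat _ _ _ P.+1) //= -[RHS]Rplus_0_r; congr (_ + _)%R.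
  rewrite big_nat_cond big1 // => j /andP[hj _].
  by rewrite bin_small /=; [ring|lia].
have A : (\rsum_(1 <= i < (n + S).+2) INR 'C(i - 1, S) * ((-1) ^ (P.+1 + i) * INR 'C(P, i - 1))
    = if P == S then 1 else 0)%R.
  rewrite big_add1 -[RHS](_ : (-1) ^ P * (if P == S then (-1) ^ S else 0) = _)%R; last first.
    case: eqP => [->|_]; last by ring.
    have : ((-1) ^ 2 = 1)%R by ring.
    by move=> e; rewrite -Rpow_mult_distr (_ : -1 * -1 = 1)%R ?pow1 //; ring.
  rewrite -binomial_orthogonality -trunc big_distrr; apply: eq_big_nat => j hj.
  rewrite subn1 (_ : (P.+1 + j.+1)%N = Nat.add 2 (Nat.add P j)) ?pow_add /=; [ring|lia].
have B : (\rsum_(1 <= i < (n + S).+2) INR 'C(i - 1, S) *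
    ((-1) ^ ((n + S).+2 - i) * INR 'C(P, (n + S).+2 - i - 1)) = - INR 'C(n + S - P, n))%R.
  rewrite -binomial_alternating -?trunc; last by lia.
  rewrite -(rsum_opp _ _ _ predT) big_nat_rev big_add1 /=; apply: eq_big_nat => j hj.
  rewrite (_ : (n + S).+2 - (1 + (n + S).+2 - j.+2) = j.+1)%N; last by lia.
  rewrite (_ : 1 + (n + S).+2 - j.+2 - 1 = n + S - j)%N; last by lia.
  by rewrite subn1 /=; ring.
rewrite !subn1 (_ : ((n + S).+2 - P.+1).-1 = n + S - P)%N /=; last by lia.
rewrite eqSS -A.
under eq_bigr => i _ do rewrite Rmult_plus_distr_l.
rewrite big_split /= -!/(_ - 1)%N B; ring.
Qed.

(** * Binomial sums of the correction terms *)

Lemma binC1 r : (0 < r)%N -> binC 1 (r - 1) = delta r 1 + delta r 2.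
Proof.
by case: r => [|[|[|r]]] // _; rewrite /binC /delta subn1 ?bin0 ?binn ?bin_small //= ; ring.
Qed.

Lemma binC0 r : (0 < r)%N -> binC 0 (r - 1) = delta r 1.
Proof. by case: r => [|[|r]] // _; rewrite /binC /delta subn1 ?bin0 ?bin0n. Qed.

(** The indices [i = 1] and [i = 2] meet the same value [A (k - 2)], and for binomial [c] the
    difference [c 2 - c 1] is a single Kronecker delta. The term with [E] would need
    [i = 1 = k - i], that is [k = 2]. *)
Lemma eps_sum (c A D : nat -> C) (E : C) k : (2 < k)%N ->
  \csum_(1 <= i < k) (c i * (delta i 2 * A (k - i)%N - delta i 1 * A (k - i - 1)%N
     + delta (k - i) 1 * D i + delta i 1 * delta (k - i) 1 * E)) =
  (c 2%N - c 1%N) * A (k - 2)%N + c (k - 1)%N * D (k - 1)%N.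
Proof.
move=> hk.
transitivity (\csum_(1 <= i < k) (delta i 2 * (c i * A (k - i)%N))
  + \csum_(1 <= i < k) (delta i 1 * (- c i * A (k - i - 1)%N))
  + \csum_(1 <= i < k) (delta i (k - 1) * (c i * D i))).
  rewrite -!big_split; apply: eq_big_nat => i hi /=.
  rewrite (_ : delta (k - i) 1 = delta i (k - 1)); last first.
    by rewrite !deltaE; congr (if _ then _ else _); apply/eqP/eqP; lia.
  rewrite (_ : delta i 1 * delta i (k - 1) = RtoC 0); first by ring.
  rewrite !deltaE; case: eqP => h1; case: eqP => h2; try ring.
  by exfalso; lia.
rewrite !csum_delta; try lia.
by rewrite (_ : k - 1 - 1 = k - 2)%N; [ring|lia].
Qed.

(** * Stuffle and shuffle relations *)

Section Tau.
Variables (tau : C) (htau : (0 < Im tau)%R).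
Let q := qexp tau.
Let hq : (Cmod q < 1)%R := Cmod_qexp htau.
Let P (r m : nat) : C := Phi r (Cpow q m).

Lemma psum_phim p r : psum (sel p (P r)) (sum_pos p (fun m => phim r m tau)).
Proof.
by apply: psum_sum_pos => [m hm|]; [exact: phim_Phi|exact: pabs_sel_P].
Qed.

Lemma psum_phim_weighted p r :
  psum (sel p (fun m => RtoC (INR m) * P r m))
       (sum_pos p (fun m => RtoC (INR m) * phim r m tau)).
Proof.
apply: psum_sum_pos => [m hm|]; first by rewrite phim_Phi.
by apply: pabs_sel_weight => // m; split; [exact: pos_INR|exact: Rle_refl].
Qed.

Lemma psum_dsum p p' r s : psum (Dterm q p p' r s) (dsum p p' r s tau).
Proof.
apply: psum_sum_pos; last exact: pabs_Dterm.
case=> // m _; rewrite minusE subn1 sum_n_m_csum; apply: eq_big_nat => v hv.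
by rewrite /sel !phim_Phi //; lia.
Qed.

Lemma fo_fe_stuffle r s :
  fo r tau * Defs.fe s tau = dsum Nat.odd Nat.even r s tau + dsum Nat.even Nat.odd s r tau.
Proof.
rewrite (psum_stuffle (E := RtoC 0) (psum_phim Nat.odd r) (psum_phim Nat.even s)
  (psum_dsum _ _ _ _) (psum_dsum _ _ _ _)) ?Cplus_0_r //.
apply: clim_ext (clim_const (RtoC 0)) => n; rewrite big1 // => m _.
by rewrite /sel -Nat.negb_odd; case: Nat.odd => /=; ring.
Qed.

Lemma fo_fo_stuffle r s : (0 < r)%N -> (0 < s)%N ->
  fo r tau * fo s tau = dsum Nat.odd Nat.odd r s tau + dsum Nat.odd Nat.odd s r tau
  + (fo (r + s) tau
     + RtoC (/ 2) * (RtoC (delta0 (s - 1)) * fo r tau + RtoC (delta0 (r - 1)) * fo s tau)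
     + \csum_(2 <= p < r + s) RtoC (bern p * coefA (r - 1) (s - 1) p) * fo (r + s - p) tau).
Proof.
move=> hr hs.
apply: (psum_stuffle (psum_phim Nat.odd r) (psum_phim Nat.odd s)
  (psum_dsum _ _ _ _) (psum_dsum _ _ _ _)).
have h n := psum_phim Nat.odd n.
have H1 := psum_scal (RtoC (/ 2)) (psum_plus (psum_scal (RtoC (delta0 (s - 1))) (h r))
   (psum_scal (RtoC (delta0 (r - 1))) (h s))).
have H2 : psum (fun n => \csum_(2 <= p < r + s)
      RtoC (bern p * coefA (r - 1) (s - 1) p) * sel Nat.odd (P (r + s - p)) n)
    (\csum_(2 <= p < r + s) RtoC (bern p * coefA (r - 1) (s - 1) p) * fo (r + s - p) tau).
  by apply: psum_csum => p _; apply: psum_scal; apply: h.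
apply: psum_ext (psum_plus (psum_plus (h (r + s)%N) H1) H2) => m hm.
rewrite /sel; case: Nat.odd.
  by rewrite Phi_sqr //; apply: Cmod_Cpow_lt1.
rewrite big1 => [|p _]; ring.
Qed.

Lemma odd_sub u N : (u <= N)%N -> Nat.odd (N - u) = xorb (Nat.odd N) (Nat.odd u).
Proof. by move=> h; rewrite Nat.odd_sub //; lia. Qed.

Lemma count_odd N : (0 < N)%N ->
  \rsum_(1 <= u < N) (if Nat.odd u then 1 else 0) =
  (if Nat.odd N then / 2 * (INR N - 1) else / 2 * INR N)%R.
Proof.
elim: N => // -[|N] IH _; first by rewrite big_geq //=; ring.
rewrite big_nat_recr // IH // (Nat.odd_succ N.+1) -Nat.negb_odd (S_INR N.+1).
by move: (INR N.+1) => x; case: (Nat.odd N.+1) => /=; field.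
Qed.

(** An odd [N] has [(N - 1) / 2] odd numbers below it: the part [N] gives [fbaro], the part [-1]
    gives [fo]. *)
Lemma fo_fe_shuffle r s : (0 < r)%N -> (0 < s)%N ->
  fo r tau * Defs.fe s tau =
  \csum_(1 <= i < r + s) binC (i - 1) (s - 1) * dsum Nat.odd Nat.odd i (r + s - i) tau
  + \csum_(1 <= i < r + s) binC (i - 1) (r - 1) * dsum Nat.odd Nat.even i (r + s - i) tau
  + binC (r + s - 2) (r - 1) * (RtoC (/ 2) * (fbaro (r + s - 2) tau + fo (r + s - 1) tau)).
Proof.
move=> hr hs.
apply: (psum_unique (psum_cauchy (pabs_sel_P hq Nat.odd r) (pabs_sel_P hq Nat.even s)
  (psum_phim _ _) (psum_phim _ _))).
have -> : binC (r + s - 2) (r - 1) * (RtoC (/ 2) * (fbaro (r + s - 2) tau + fo (r + s - 1) tau)) =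
  - binC (r + s - 2) (r - 1) * (RtoC (/ 2) *
    (sum_pos Nat.odd (fun m => RtoC (INR m) * phim (r + s - 1) m tau)
     + - RtoC 1 * sum_pos Nat.odd (fun m => phim (r + s - 1) m tau))).
  rewrite /fbaro plusE (_ : r + s - 2 + 1 = r + s - 1)%N; last by lia.
  by rewrite -/(fo _ _); ring.
have h1 := psum_scal (- binC (r + s - 2) (r - 1)) (psum_scal (RtoC (/ 2))
  (psum_plus (psum_phim_weighted Nat.odd (r + s - 1))
     (psum_scal (- RtoC 1) (psum_phim Nat.odd (r + s - 1))))).
have h2 : psum (fun N => \csum_(1 <= i < r + s)
    binC (i - 1) (s - 1) * Dterm q Nat.odd Nat.odd i (r + s - i) N)
    (\csum_(1 <= i < r + s) binC (i - 1) (s - 1) * dsum Nat.odd Nat.odd i (r + s - i) tau).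
  by apply: psum_csum => i _; apply: psum_scal; apply: psum_dsum.
have h3 : psum (fun N => \csum_(1 <= i < r + s)
    binC (i - 1) (r - 1) * Dterm q Nat.odd Nat.even i (r + s - i) N)
    (\csum_(1 <= i < r + s) binC (i - 1) (r - 1) * dsum Nat.odd Nat.even i (r + s - i) tau).
  by apply: psum_csum => i _; apply: psum_scal; apply: psum_dsum.
apply: psum_ext (psum_plus (psum_plus h2 h3) h1) => N hN.
rewrite (conv_shuffle hq (pN := Nat.odd) hr hs); last 2 first.
- by move=> u hu; rewrite -Nat.negb_odd odd_sub; [case: Nat.odd; case: Nat.odd|lia].
- by move=> u hu; rewrite -Nat.negb_odd odd_sub; [case: Nat.odd; case: Nat.odd|lia].
congr (_ + _ * _); rewrite /sel count_odd //; case: Nat.odd; last by ring.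
by rewrite RtoC_mult RtoC_minus /P; ring.
Qed.

(** An even [N] has exactly [N / 2] odd numbers below it, so here only [fbare] appears. *)
Lemma fo_fo_shuffle r s : (0 < r)%N -> (0 < s)%N ->
  fo r tau * fo s tau =
  \csum_(1 <= i < r + s) binC (i - 1) (s - 1) * dsum Nat.even Nat.odd i (r + s - i) tau
  + \csum_(1 <= i < r + s) binC (i - 1) (r - 1) * dsum Nat.even Nat.odd i (r + s - i) tau
  + binC (r + s - 2) (r - 1) * (RtoC (/ 2) * fbare (r + s - 2) tau).
Proof.
move=> hr hs.
apply: (psum_unique (psum_cauchy (pabs_sel_P hq Nat.odd r) (pabs_sel_P hq Nat.odd s)
  (psum_phim _ _) (psum_phim _ _))).
have -> : binC (r + s - 2) (r - 1) * (RtoC (/ 2) * fbare (r + s - 2) tau) =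
  - binC (r + s - 2) (r - 1) * (RtoC (/ 2) *
    sum_pos Nat.even (fun m => RtoC (INR m) * phim (r + s - 1) m tau)).
  rewrite /fbare plusE (_ : r + s - 2 + 1 = r + s - 1)%N; last by lia.
  by ring.
have h1 := psum_scal (- binC (r + s - 2) (r - 1)) (psum_scal (RtoC (/ 2))
  (psum_phim_weighted Nat.even (r + s - 1))).
have h2 c : psum (fun N => \csum_(1 <= i < r + s)
    binC (i - 1) c * Dterm q Nat.even Nat.odd i (r + s - i) N)
    (\csum_(1 <= i < r + s) binC (i - 1) c * dsum Nat.even Nat.odd i (r + s - i) tau).
  by apply: psum_csum => i _; apply: psum_scal; apply: psum_dsum.
apply: psum_ext (psum_plus (psum_plus (h2 (s - 1)%N) (h2 (r - 1)%N)) h1) => N hN.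
rewrite (conv_shuffle hq (pN := Nat.even) hr hs); last 2 first.
- by move=> u hu; rewrite -Nat.negb_odd odd_sub; [case: Nat.odd; case: Nat.odd|lia].
- by move=> u hu; rewrite -Nat.negb_odd odd_sub; [case: Nat.odd; case: Nat.odd|lia].
congr (_ + _ * _); rewrite /sel count_odd // -Nat.negb_odd; case: Nat.odd => /=; first by ring.
by rewrite RtoC_mult /P; ring.
Qed.

Lemma quarterE : quarter = RtoC (/ 2) * RtoC (/ 2).
Proof. by rewrite /quarter -RtoC_mult; congr RtoC; field. Qed.

(** Between [epsoe r s] and [epseo s r] the terms with [delta r 1] and [delta s 1] cancel, as do
    [alpha1] and [alpha2]; the two terms with index 2 remain. *)
Lemma oe_stuffle r s :
  Zo r tau * Ze s tau
    + quarter * (delta r 2 * fbare s tau + delta s 2 * fbaro r tau)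
  = Zoe r s tau + Zeo s r tau.
Proof.
have := fo_fe_stuffle r s.
rewrite /Zo /Ze /Zoe /Zeo /epsoe /epseo /alpha1 /alpha2 => H.
rewrite (_ : fo r tau * (zetat s + Defs.fe s tau) = fo r tau * Defs.fe s tau + zetat s * fo r tau); last by ring.
rewrite H; ring.
Qed.

Lemma delta_pred a : (0 < a)%N -> RtoC (delta0 (a - 1)) = delta a 1.
Proof. by case: a => // a _; rewrite delta_delta0 subn1. Qed.

(** Adding the brackets for [(r, s)] and [(s, r)] gives [-(1 + (-1)^p)] times
    [coefA (r - 1) (s - 1) p], to which [zetat_bern] applies. The term [p = 1] drops out since
    [zetat 1] is zero. *)
Lemma oo_zeta_terms r s : (0 < r)%N -> (0 < s)%N ->
  sum_pairs (r + s) (fun p h =>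
    (sgnC s * binC (p - 1) (s - 1) + sgnC (p + r) * binC (p - 1) (r - 1)) * zetat p * fo h tau)
  + sum_pairs (s + r) (fun p h =>
    (sgnC r * binC (p - 1) (r - 1) + sgnC (p + s) * binC (p - 1) (s - 1)) * zetat p * fo h tau)
  = \csum_(2 <= p < r + s) RtoC (bern p * coefA (r - 1) (s - 1) p) * fo (r + s - p) tau.
Proof.
move=> hr hs; rewrite !sum_pairsE ?addn_gt0 ?hr ?hs // (addnC s r) -big_split /=.
rewrite big_ltn; last by lia.
rewrite (_ : zetat 1 = RtoC 0) // !Cmult_0_r !Cmult_0_l !Cplus_0_l.
apply: eq_big_nat => p /andP[hp _].
have hsgn n : sgnC (p + n) = sgnC p * sgnC n by rewrite /sgnC Cpow_add_r.
have hsS n : (0 < n)%N -> sgnC n = - RtoC ((-1) ^ (n - 1)).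
  case: n => // n _; rewrite subn1 /sgnC -RtoC_pow -RtoC_opp -tech_pow_Rmult; congr RtoC; rewrite /=; ring.
have hb : RtoC (bern p) = - ((RtoC 1 + sgnC p) * zetat p) by rewrite zetat_bern //; ring.
rewrite RtoC_mult hb /coefA RtoC_plus !RtoC_mult -!/(binC _ _) ?plusE ?minusE !hsgn.
by rewrite (hsS r) // (hsS s) //; ring.
Qed.

(** The terms [2 * fo] in [epsoo] supply the half-weight terms of the diagonal. At [r = s = 1] the
    right side would exceed the left by [alpha3 / 2], a nonzero function, hence the exclusion. *)
Lemma oo_stuffle r s : (0 < r)%N -> (0 < s)%N -> (r, s) <> (1, 1)%N ->
  Zo r tau * Zo s tau
    + quarter * (delta r 2 * fbaro s tau + delta s 2 * fbaro r tau)
  = Zoo r s tau + Zoo s r tau + Zo (r + s) tau.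
Proof.
move=> hr hs hrs; have := fo_fo_stuffle hr hs.
rewrite -(oo_zeta_terms hr hs) !delta_pred // /Zo /Zoo => ->.
have hd : delta r 1 * delta s 1 = RtoC 0.
  rewrite !deltaE; case: eqP => h1; case: eqP => h2; try ring.
  by case: hrs; rewrite h1 h2.
have hd' : delta s 1 * delta r 1 = RtoC 0 by rewrite Cmult_comm.
rewrite /epsoo ?minusE ?plusE hd hd' quarterE.
have e2 : RtoC (/ 2) * RtoC 2 = RtoC 1 by rewrite -RtoC_mult; congr RtoC; field.
set S1 := sum_pairs _ _; set S2 := sum_pairs _ _.
transitivity (dsum Nat.odd Nat.odd r s tau + dsum Nat.odd Nat.odd s r tau + S1 + S2 + fo (r + s) tau
  + RtoC (/ 2) * RtoC (/ 2) * (delta r 2 * fbaro s tau + delta s 2 * fbaro r tau)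
  + RtoC (/ 2) * (RtoC (/ 2) * RtoC 2) * (delta s 1 * fo r tau + delta r 1 * fo s tau)).
  by rewrite e2; ring.
by ring.
Qed.

Lemma oe_zeta_terms r s : (0 < r)%N -> (0 < s)%N ->
  \csum_(1 <= i < r + s) binC (i - 1) (r - 1) * (zetat (r + s - i) * fo i tau)
  + \csum_(1 <= i < r + s) binC (i - 1) (s - 1) *
      sum_pairs (r + s) (fun p h =>
       (sgnC (r + s - i) * binC (p - 1) (r + s - i - 1) + sgnC (p + i) * binC (p - 1) (i - 1))
       * zetat p * fo h tau)
  = zetat s * fo r tau.
Proof.
move=> hr hs.
transitivity (\csum_(1 <= p < r + s) (delta p s * (zetat p * fo (r + s - p) tau))); last first.
  by rewrite csum_delta ?addnK //; lia.
rewrite big_nat_rev.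
under [X in _ + X]eq_bigr => i _ do rewrite sum_pairsE ?addn_gt0 ?hr // big_distrr /=.
rewrite [X in _ + X]exchange_big -big_split; apply: eq_big_nat => p hp /=.
have := zeta_coefficient hr hs hp; move/(congr1 RtoC).
rewrite RtoC_plus csum_RtoC.
rewrite (_ : RtoC (if p == s then 1 else 0)%R = delta p s); last by rewrite deltaE; case: eqP.
move=> <-.
rewrite Cmult_plus_distr_r big_distrl /=; congr (_ + _).
  rewrite (_ : 1 + (r + s) - p.+1 = r + s - p)%N; last by lia.
  by rewrite (_ : r + s - (r + s - p) = p)%N //; lia.
apply: eq_bigr => i _; rewrite ?plusE ?minusE.
by rewrite RtoC_mult RtoC_plus !RtoC_mult !RtoC_pow /binC /sgnC; ring.
Qed.

End Tau.

(** * Correction terms and assembly of the shuffle relations *)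

Lemma RtoC2 : RtoC 2 = RtoC 1 + RtoC 1.
Proof. by rewrite -RtoC_plus; congr RtoC; ring. Qed.

Lemma delta2_index (f : nat -> C) r s : (0 < s)%N -> delta r 2 * f s = delta r 2 * f (r + s - 2)%N.
Proof. by move=> hs; rewrite deltaE; case: eqP => [->|_]; [rewrite addKn|ring]. Qed.

Lemma binC_sym r s : (0 < r)%N -> (0 < s)%N ->
  binC (r + s - 2) (s - 1) = binC (r + s - 2) (r - 1).
Proof.
move=> hr hs; rewrite /binC -(@bin_sub (r + s - 2) (r - 1)); last by lia.
by congr (RtoC (INR 'C(_, _))); lia.
Qed.

(** A quarter of the last summand is the diagonal contribution in [fo_fe_shuffle]. The case
    [r = s = 1] is separate: there [alpha2] and [alpha3] make the identity hold. *)
Lemma eps_oe_oo r s tau : (0 < r)%N -> (0 < s)%N ->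
  \csum_(1 <= i < r + s) binC (i - 1) (r - 1) * epsoe i (r + s - i) tau
  + \csum_(1 <= i < r + s) binC (i - 1) (s - 1) * epsoo i (r + s - i) tau
  = delta r 2 * fbare s tau + delta s 2 * fbaro r tau
    + RtoC 2 * (binC (r + s - 2) (r - 1) * (fbaro (r + s - 2) tau + fo (r + s - 1) tau)).
Proof.
move=> hr hs; rewrite /epsoe /epsoo minusE; case: (ltnP 2 (r + s)) => h; last first.
  have -> : r = 1%N by lia.
  have -> : s = 1%N by lia.
  rewrite !big_nat1 (_ : 1 + 1 - 2 = 0)%N // (_ : 1 + 1 - 1 = 1)%N //.
  by rewrite /binC /alpha2 /alpha3 /delta /= subnn; ring.
rewrite (eps_sum (fun i => binC (i - 1) (r - 1)) (fun i => fbare i tau)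
  (fun i => fbaro (i - 1) tau)) //.
rewrite (eps_sum (fun i => binC (i - 1) (s - 1)) (fun i => fbaro i tau)
  (fun i => fbaro (i - 1) tau + RtoC 2 * fo i tau)) //.
rewrite (delta2_index (fun n => fbare n tau)) // (delta2_index (fun n => fbaro n tau)) //.
rewrite (addnC s r) (_ : r + s - 1 - 1 = r + s - 2)%N; last by lia.
rewrite binC_sym // subnn (_ : 2 - 1 = 1)%N // !binC1 // !binC0 //; ring.
Qed.

Lemma eps_eo r s tau : (0 < r)%N -> (0 < s)%N ->
  \csum_(1 <= i < r + s) (binC (i - 1) (r - 1) + binC (i - 1) (s - 1)) * epseo i (r + s - i) tau
  = delta r 2 * fbaro s tau + delta s 2 * fbaro r tau
    + RtoC 2 * (binC (r + s - 2) (r - 1) * fbare (r + s - 2) tau).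
Proof.
move=> hr hs; rewrite /epseo minusE; case: (ltnP 2 (r + s)) => h; last first.
  have -> : r = 1%N by lia.
  have -> : s = 1%N by lia.
  rewrite !big_nat1 (_ : 1 + 1 - 2 = 0)%N // (_ : 1 + 1 - 1 = 1)%N //.
  by rewrite /binC /alpha1 /delta RtoC2 /= subnn; ring.
rewrite (eps_sum (fun i => binC (i - 1) (r - 1) + binC (i - 1) (s - 1)) (fun i => fbaro i tau)
  (fun i => fbare (i - 1) tau)) //.
rewrite (@delta2_index (fun n => fbaro n tau) r s hs) (@delta2_index (fun n => fbaro n tau) s r hr).
rewrite (addnC s r) (_ : r + s - 1 - 1 = r + s - 2)%N; last by lia.
rewrite binC_sym // subnn (_ : 2 - 1 = 1)%N // !binC1 // !binC0 //.
by rewrite RtoC2; ring.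
Qed.

Lemma quarter_2 z : quarter * (RtoC 2 * z) = RtoC (/ 2) * z.
Proof. by rewrite Cmult_assoc -RtoC_mult; congr (RtoC _ * _); field. Qed.

(** Three layers are matched independently: double sums by [fo_fe_shuffle], zeta terms by
    [oe_zeta_terms], corrections by [eps_oe_oo], whose surplus is the diagonal term of the first
    layer. *)
Lemma oe_shuffle r s tau : (0 < Im tau)%R -> (0 < r)%N -> (0 < s)%N ->
  Zoe r s tau + Zeo s r tau
  = sum_pairs (r + s) (fun i j => binC (i - 1) (r - 1) * Zoe i j tau)
    + sum_pairs (r + s) (fun i j => binC (i - 1) (s - 1) * Zoo i j tau).
Proof.
move=> h hr hs; rewrite -oe_stuffle // /Zo /Ze !sum_pairsE ?addn_gt0 ?hr //.
transitivity (
  (\csum_(1 <= i < r + s) binC (i - 1) (r - 1) * dsum Nat.odd Nat.even i (r + s - i) tau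
  + \csum_(1 <= i < r + s) binC (i - 1) (r - 1) * (zetat (r + s - i) * fo i tau)
  + quarter * \csum_(1 <= i < r + s) binC (i - 1) (r - 1) * epsoe i (r + s - i) tau)
 + (\csum_(1 <= i < r + s) binC (i - 1) (s - 1) * dsum Nat.odd Nat.odd i (r + s - i) tau
  + \csum_(1 <= i < r + s) binC (i - 1) (s - 1) *
      sum_pairs (r + s) (fun p h =>
       (sgnC (r + s - i) * binC (p - 1) (r + s - i - 1) + sgnC (p + i) * binC (p - 1) (i - 1))
       * zetat p * fo h tau)
  + quarter * \csum_(1 <= i < r + s) binC (i - 1) (s - 1) * epsoo i (r + s - i) tau)); last first.
  congr (_ + _); rewrite big_distrr -!big_split; apply: eq_big_nat => i hi /=.
    by rewrite /Zoe; ring.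
  by rewrite /Zoo plusE minusE subnKC; [ring|lia].
have e1 := fo_fe_shuffle h hr hs; have e2 := oe_zeta_terms tau hr hs.
have e3 := eps_oe_oo tau hr hs.
rewrite (_ : fo r tau * (zetat s + Defs.fe s tau) =
  fo r tau * Defs.fe s tau + zetat s * fo r tau); last by ring.
rewrite e1 -e2.
have e4 := congr1 (Cmult quarter) e3.
rewrite Cmult_plus_distr_l (Cmult_plus_distr_l _ (_ + _)) quarter_2 in e4.
move: e4.
move: (quarter * \csum_(1 <= i < r + s) binC (i - 1) (r - 1) * epsoe i (r + s - i) tau).
move: (quarter * \csum_(1 <= i < r + s) binC (i - 1) (s - 1) * epsoo i (r + s - i) tau).
move: (quarter * (delta r 2 * _ + _)) => y d c e4.
rewrite (_ : forall z, z + d = z + (c + d) - c); last by move=> z; ring.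
by rewrite e4; ring.
Qed.

Lemma oo_shuffle r s tau : (0 < Im tau)%R -> (0 < r)%N -> (0 < s)%N ->
  Zo r tau * Zo s tau
    + quarter * (delta r 2 * fbaro s tau + delta s 2 * fbaro r tau)
  = sum_pairs (r + s) (fun i j =>
       (binC (i - 1) (r - 1) + binC (i - 1) (s - 1)) * Zeo i j tau).
Proof.
move=> h hr hs; rewrite /Zo sum_pairsE ?addn_gt0 ?hr // fo_fo_shuffle //.
transitivity (
  \csum_(1 <= i < r + s) binC (i - 1) (s - 1) * dsum Nat.even Nat.odd i (r + s - i) tau
  + \csum_(1 <= i < r + s) binC (i - 1) (r - 1) * dsum Nat.even Nat.odd i (r + s - i) tau
  + quarter * \csum_(1 <= i < r + s)
      (binC (i - 1) (r - 1) + binC (i - 1) (s - 1)) * epseo i (r + s - i) tau); last first.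
  rewrite big_distrr -!big_split; apply: eq_big_nat => i hi /=.
  by rewrite /Zeo; ring.
rewrite eps_eo // (Cmult_plus_distr_l quarter (_ + _)) quarter_2; ring.
Qed.

End DoubleSums.

Theorem theorem6 (r s : nat) (hr : (1 <= r)%nat) (hs : (1 <= s)%nat)
    (tau : C) (htau : (0 < Im tau)%R) :
  (Zo r tau * Ze s tau
     + quarter * (delta r 2 * fbare s tau + delta s 2 * fbaro r tau)
   = Zoe r s tau + Zeo s r tau
   /\
   Zoe r s tau + Zeo s r tau
   = sum_pairs (r + s) (fun i j => binC (i - 1) (r - 1) * Zoe i j tau)
     + sum_pairs (r + s) (fun i j => binC (i - 1) (s - 1) * Zoo i j tau))
  /\
  (((r, s) <> (1, 1)%nat ->
      Zo r tau * Zo s tau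
        + quarter * (delta r 2 * fbaro s tau + delta s 2 * fbaro r tau)
      = Zoo r s tau + Zoo s r tau + Zo (r + s) tau)
   /\
   Zo r tau * Zo s tau
     + quarter * (delta r 2 * fbaro s tau + delta s 2 * fbaro r tau)
   = sum_pairs (r + s) (fun i j =>
       (binC (i - 1) (r - 1) + binC (i - 1) (s - 1)) * Zeo i j tau)).
Proof.
pose proof (ssrbool.introT ssrnat.leP hr) as hr'.
pose proof (ssrbool.introT ssrnat.leP hs) as hs'.
split; split.
- exact (DoubleSums.oe_stuffle htau r s).
- exact (DoubleSums.oe_shuffle htau hr' hs').
- exact (DoubleSums.oo_stuffle htau hr' hs').
- exact (DoubleSums.oo_shuffle htau hr' hs').
Qed.
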